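(* Let $n\ge2$ and, for $\lambda>0$, consider the hyperbolic manifold $$\big(\mathbb{R}^n\times\mathbb{S}^1(\lambda),\ g^+=dt^2+\sinh^2t\,g_{\mathbb{S}^{n-1}}+\cosh^2t\,g_{\mathbb{S}^1(\lambda)}\big).$$ If $\lambda$ is small enough, then the relative volume function $\mathcal{A}$ of $(\mathbb{R}^n\times\mathbb{S}^1(\lambda),g^+)$ is not a constant function.
   Context: Polar coordinates $(t,w)\in[0,+\infty)\times\mathbb{S}^{n-1}$ are used on $\mathbb{R}^n$; $g_{\mathbb{S}^{n-1}}$ is the standard round metric on the unit sphere, and $\mathbb{S}^1(\lambda)$ is the circle of radius $\lambda$ (length $2\pi\lambda$) with its standard metric $g_{\mathbb{S}^1(\lambda)}$. The manifold $X=\mathbb{R}^n\times\mathbb{S}^1(\lambda)$ has dimension $n+1$, and its relative volume function is $$\mathcal{A}(p)=2^n\lim_{s\to+\infty}e^{-ns}\,\mathrm{Vol}(\partial B_{g^+}(p,s)),\qquad p\in X,$$ where $B_{g^+}(p,s)$ is the geodesic ball of radius $s$ centered at $p$ and $\mathrm{Vol}(\partial B_{g^+}(p,s))$ is the $n$-dimensional volume of the geodesic sphere with respect to $g^+$ (the limit exists). *)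

(* Defs.v *)
From mathcomp Require Import all_boot all_order all_algebra.
From mathcomp Require Import all_classical all_reals all_analysis.
Set Implicit Arguments.
Unset Strict Implicit.
Unset Printing Implicit Defensive.
Import Order.TTheory GRing.Theory Num.Theory.
Import numFieldNormedType.Exports.
Local Open Scope classical_set_scope.
Local Open Scope ring_scope.

Section Euclidean.
Context {R : realType}.

Definition sinh (x : R) : R := (expR x - expR (- x)) / 2.
Definition cosh (x : R) : R := (expR x + expR (- x)) / 2.

Definition dot m (u v : 'rV[R]_m) : R := \sum_i u 0 i * v 0 i.

(* The library norm on 'rV[R]_m is the sup norm, hence this one. *)
Definition enorm m (v : 'rV[R]_m) : R := Num.sqrt (dot v v).

Definition velocity m (x : R -> 'rV[R]_m) (u : R) : 'rV[R]_m :=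
  \row_i derive1 (fun v => x v 0 i) u.

Definition C1 m (x : R -> 'rV[R]_m) : Prop :=
  forall i, (forall u, derivable (fun v => x v 0 i) u 1) /\
            continuous (derive1 (fun v => x v 0 i)).

End Euclidean.

Section HausdorffMeasure.
Context {R : realType}.
Local Open Scope ereal_scope.

(* Lebesgue volume of the Euclidean unit ball of R^k, by the classical
   two-step recursion omega_(k+2) = 2 pi / (k+2) * omega_k. *)
Fixpoint unit_ball_volume (k : nat) : R :=
  match k with
  | 0 => 1
  | 1 => 2
  | k'.+2 => (2 * pi / k'.+2%:R * unit_ball_volume k')%R
  end.

Variables (T : Type) (d : T -> T -> R).

(* The added 0 makes the empty set have diameter 0 (not -oo). *)
Definition diameter (U : set T) : \bar R :=
  ereal_sup ([set 0] `|` [set (d xy.1 xy.2)%:E | xy in U `*` U]).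

Definition hausdorff_premeasure (k : nat) (delta : R) (E : set T) : \bar R :=
  ereal_inf [set \sum_(i <oo)
                   (unit_ball_volume k / 2 ^+ k)%:E * diameter (U i) ^+ k
            | U in [set U : nat -> set T |
                     (forall i, diameter (U i) <= delta%:E) /\
                     E `<=` \bigcup_i U i]].

(* k-dimensional Hausdorff measure (k > 0) of the distance d, normalized so
   that for a Riemannian distance it is the k-dimensional Riemannian volume on
   k-dimensional submanifolds; it needs no smoothness of E. *)
Definition hausdorff_measure (k : nat) (E : set T) : \bar R :=
  ereal_sup [set hausdorff_premeasure k delta E
            | delta in [set delta : R | (0 < delta)%R]].

End HausdorffMeasure.

Section HyperbolicManifold.
Context {R : realType}.
Variables (n : nat) (lambda : R).

(* R^n x S^1(lambda), with S^1(lambda) the circle of radius lambda in R^2. *)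
Definition X := {p : 'rV[R]_n * 'rV[R]_2 | enorm p.2 == lambda}.

(* Differentials at x != 0, in the direction v, of the polar coordinates
   t = |x| and w = x / |x|. *)
Definition dt (x v : 'rV[R]_n) : R := dot x v / enorm x.
Definition dw (x v : 'rV[R]_n) : 'rV[R]_n :=
  (enorm x)^-1 *: (v - dt x v *: ((enorm x)^-1 *: x)).

(* g^+ = dt^2 + sinh^2 t g_{S^(n-1)} + cosh^2 t g_{S^1(lambda)}, as a quadratic
   form on tangent vectors (v, z) at points with R^n-component x; the round
   metrics are those induced by the Euclidean ones.  At x = 0 the value is the
   one given by the smooth extension across t = 0. *)
Definition gplus (x v : 'rV[R]_n) (z : 'rV[R]_2) : R :=
  if x == 0 then dot v v + dot z z
  else dt x v ^+ 2 + sinh (enorm x) ^+ 2 * dot (dw x v) (dw x v)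
       + cosh (enorm x) ^+ 2 * dot z z.

(* C^1 arcs parametrized by [0, 1].  Asking for C^1 coordinates on all of R is
   no restriction: a C^1 map on [0, 1] extends affinely on both sides. *)
Definition C1_arc (x : R -> 'rV[R]_n) (y : R -> 'rV[R]_2) (p q : X) : Prop :=
  [/\ C1 x, C1 y,
      forall u, u \in `[0, 1] -> enorm (y u) = lambda,
      (x 0, y 0) = sval p & (x 1, y 1) = sval q].

Definition arc_length (x : R -> 'rV[R]_n) (y : R -> 'rV[R]_2) : R :=
  \int[@lebesgue_measure R]_(u in `[0, 1])
     Num.sqrt (gplus (x u) (velocity x u) (velocity y u)).

(* [joined p q l]: some piecewise C^1 curve from p to q has length l. *)
Inductive joined : X -> X -> R -> Prop :=
| joined_nil p : joined p p 0
| joined_cons p q r x y l :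
    C1_arc x y p q -> joined q r l -> joined p r (arc_length x y + l).

Definition riem_dist (p q : X) : R := inf [set l | joined p q l].

Definition geodesic_ball (p : X) (s : R) : set X := [set q | riem_dist p q < s].

(* Topological boundary, for the topology of the Riemannian distance. *)
Definition boundary (A : set X) : set X :=
  [set q | forall e : R, 0 < e ->
     (exists r, riem_dist q r < e /\ A r) /\
     (exists r, riem_dist q r < e /\ ~ A r)].

Definition sphere_volume (p : X) (s : R) : \bar R :=
  hausdorff_measure riem_dist n (boundary (geodesic_ball p s)).

Definition relative_volume (p : X) : \bar R :=
  ((2 ^+ n)%:E *
   lim ((expR (- (n%:R * s)))%:E * sphere_volume p s @[s --> +oo%R]))%E.

End HyperbolicManifold.

(* Main.v *)
Require Import Defs.
From mathcomp Require Import all_boot all_order all_algebra.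
From mathcomp Require Import all_classical all_reals all_analysis.
From mathcomp Require Import ring lra measurable_realfun.
Set Implicit Arguments.
Unset Strict Implicit.
Unset Printing Implicit Defensive.
Import Order.TTheory GRing.Theory Num.Theory.
Import numFieldNormedType.Exports.
Local Open Scope classical_set_scope.
Local Open Scope ring_scope.

(** The manifold is the quotient of hyperbolic space by a translation of length
   [2 * pi * lambda] along the axis [x = 0]. Replacing the point of the circle by its arc
   length [th] gives Fermi coordinates [(x, th)] of hyperbolic space, and [hpt] maps them to the
   hyperboloid of Minkowski space, where [gplus] becomes the restriction of the Minkowski form
   (der_hpt).

   Distances are computed by comparing with the hyperboloid. A curve lifts, and for a unit
   spacelike vector [N] the function [asinh (eta N Q)] is 1-Lipschitz, so the length of the
   curve is at least the hyperbolic distance of the ends of the lift (joined_lift);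
   conversely, hyperbolic geodesics project to curves of the same length (joined_geodesic).
   Hence [riem_dist p q] is the least hyperbolic distance between lifts. For a point [p] with
   [th = 0] the nearest lift of [q] is the one in the slab [|th| <= pi * lambda]
   (riem_dist_slab). Thus the geodesic sphere of radius [s] about [p] is the part of the
   hyperbolic sphere that lies in the slab (boundary_ball), and what matters is how large the
   slab looks from [p].

   The limit in the definition of the relative volume function exists at such points, because
   the volume of the sphere divided by [sinh s ^+ n] decreases: contracting a sphere to a
   smaller concentric one keeps it in the slab and scales chords by the ratio of the [sinh] of
   the radii (sphere_volume_mono).

   From a point of the axis a thin slab is seen as the band [|u| <= tanh M / tanh s] around the
   equator of the unit sphere, where [M = pi * lambda]. So the volume is at most a constant
   times [lambda * sinh s ^+ n] (sphere_volume_le). From a point at distance [t0] of the axis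
   with [sinh M * cosh t0 >= 2 * cosh M], the slab contains a patch of the sphere
   whose volume is at least [sinh s ^+ n] times a constant independent of [lambda]
   (sphere_volume_ge). Such [t0] exist for every [lambda]; when [lambda] is small the two limits
   are different.

   Hausdorff measures are estimated from above by finite covers and Lipschitz maps. From below
   one needs that a set with a Lipschitz map onto the unit cube has positive measure
   (hausdorff_measure_ge_cube); this comes from the fact that boxes covering the cube have total
   volume at least 1 (box_cover). *)

(** * Hyperbolic functions *)

Section HyperbolicFunctions.
Context {R : realType}.
Implicit Types x y r : R.

Definition asinh (x : R) : R := ln (x + Num.sqrt (x ^+ 2 + 1)).

Lemma expRMN x : expR x * expR (- x) = 1.
Proof. by rewrite -expRD subrr expR0. Qed.

Lemma sinh0 : sinh (0 : R) = 0.
Proof. by rewrite /sinh oppr0 subrr mul0r. Qed.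

Lemma cosh0 : cosh (0 : R) = 1.
Proof. by rewrite /cosh oppr0 expR0; field. Qed.

Lemma sinhN x : sinh (- x) = - sinh x.
Proof. by rewrite /sinh opprK; field. Qed.

Lemma coshN x : cosh (- x) = cosh x.
Proof. by rewrite /cosh opprK addrC. Qed.

Lemma cosh_norm x : cosh `|x| = cosh x.
Proof. by case: (ger0P x) => // _; rewrite coshN. Qed.

Lemma cosh2E x : cosh x ^+ 2 = 1 + sinh x ^+ 2.
Proof.
rewrite /cosh /sinh; have := expRMN x.
set a := expR x; set b := expR (- x) => h.
have -> : ((a + b) / 2) ^+ 2 = a * b + ((a - b) / 2) ^+ 2 by field.
by rewrite h.
Qed.

Lemma sinhD x y : sinh (x + y) = sinh x * cosh y + cosh x * sinh y.
Proof. by rewrite /sinh /cosh opprD !expRD; field. Qed.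

Lemma coshD x y : cosh (x + y) = cosh x * cosh y + sinh x * sinh y.
Proof. by rewrite /sinh /cosh opprD !expRD; field. Qed.

Lemma sinhB x y : sinh (x - y) = sinh x * cosh y - cosh x * sinh y.
Proof. by rewrite sinhD coshN sinhN mulrN. Qed.

Lemma coshB x y : cosh (x - y) = cosh x * cosh y - sinh x * sinh y.
Proof. by rewrite coshD coshN sinhN mulrN. Qed.

Lemma cosh_gt0 x : 0 < cosh x.
Proof. by rewrite /cosh divr_gt0// addr_gt0// expR_gt0. Qed.

Lemma cosh_ge1 x : 1 <= cosh x.
Proof.
have := cosh2E x; have := cosh_gt0 x; have := sqr_ge0 (sinh x).
set c := cosh x; set s := sinh x ^+ 2; nra.
Qed.

Lemma ltr_sinh : {mono (@sinh R) : x y / x < y}.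
Proof.
apply: leW_mono; apply: le_mono => x y xy.
have h1 : expR x < expR y by rewrite ltr_expR.
have h2 : expR (- y) < expR (- x) by rewrite ltr_expR ltrN2.
rewrite /sinh; lra.
Qed.

Lemma ler_sinh : {mono (@sinh R) : x y / x <= y}.
Proof. by move=> x y; rewrite !leNgt ltr_sinh. Qed.

Lemma sinh_inj : injective (@sinh R).
Proof. by move=> x y xy; apply/eqP; rewrite eq_le -(ler_sinh x) -(ler_sinh y) xy lexx. Qed.

Lemma sinh_ge0 x : (0 <= sinh x) = (0 <= x).
Proof. by rewrite -(ler_sinh 0 x) sinh0. Qed.

Lemma sinh_gt0 x : (0 < sinh x) = (0 < x).
Proof. by rewrite -(ltr_sinh 0 x) sinh0. Qed.

Lemma ltr_cosh_pos x y : 0 <= x -> 0 <= y -> (cosh x < cosh y) = (x < y).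
Proof.
move=> x0 y0.
rewrite -(@ltr_pXn2r _ 2)// ?nnegrE ?(ltW (cosh_gt0 _))//.
rewrite !cosh2E ltrD2l ltr_pXn2r// ?nnegrE ?sinh_ge0//.
by rewrite ltr_sinh.
Qed.

Lemma ler_cosh_pos x y : 0 <= x -> 0 <= y -> (cosh x <= cosh y) = (x <= y).
Proof. by move=> x0 y0; rewrite !leNgt ltr_cosh_pos. Qed.

Lemma norm_sinh x : `|sinh x| = sinh `|x|.
Proof.
case: (ger0P x) => h; first by rewrite ger0_norm// sinh_ge0.
by rewrite sinhN ltr0_norm// ltNge sinh_ge0 -ltNge.
Qed.

Lemma coshBsinh_gt0 r : 0 < cosh r - sinh r.
Proof.
have -> : cosh r - sinh r = expR (- r) by rewrite /cosh /sinh; field.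
exact: expR_gt0.
Qed.

Lemma sqrt_sqrD1_gt x : `|x| < Num.sqrt (x ^+ 2 + 1).
Proof.
rewrite -sqrtr_sqr ltr_sqrt; last by have := sqr_ge0 x; lra.
lra.
Qed.

Lemma asinh_arg_gt0 x : 0 < x + Num.sqrt (x ^+ 2 + 1).
Proof. by have := sqrt_sqrD1_gt x; rewrite ltr_norml => /andP[]; lra. Qed.

Lemma asinhK : cancel asinh (@sinh R).
Proof.
move=> x; rewrite /sinh expRN /asinh lnK ?posrE ?asinh_arg_gt0//.
have h := asinh_arg_gt0 x.
have e : Num.sqrt (x ^+ 2 + 1) ^+ 2 = x ^+ 2 + 1.
  by rewrite sqr_sqrtr//; have := sqr_ge0 x; lra.
move: h e; set q : R := Num.sqrt _ => h e.
have -> : (x + q)^-1 = q - x.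
  apply: (mulfI (lt0r_neq0 h)); rewrite divff ?lt0r_neq0//.
  by transitivity (q ^+ 2 - x ^+ 2); [rewrite e|]; ring.
by field.
Qed.

Lemma sinhK : cancel (@sinh R) asinh.
Proof. by move=> x; apply: sinh_inj; rewrite asinhK. Qed.

Lemma asinh0 : asinh 0 = 0.
Proof. by rewrite -[RHS]sinhK sinh0. Qed.

Lemma asinh_ge0 x : (0 <= asinh x) = (0 <= x).
Proof. by rewrite -sinh_ge0 asinhK. Qed.

Lemma asinh_gt0 x : (0 < asinh x) = (0 < x).
Proof. by rewrite -sinh_gt0 asinhK. Qed.

Lemma cosh_asinh x : cosh (asinh x) = Num.sqrt (1 + x ^+ 2).
Proof. by rewrite -[x in RHS]asinhK -cosh2E sqrtr_sqr ger0_norm// ltW// cosh_gt0. Qed.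

Lemma exists_acosh c : 1 <= c -> exists2 d : R, 0 <= d & cosh d = c.
Proof.
move=> c1; exists (asinh (Num.sqrt (c ^+ 2 - 1))); first by rewrite asinh_ge0 sqrtr_ge0.
rewrite cosh_asinh sqr_sqrtr; last by nra.
by rewrite addrC subrK sqrtr_sqr ger0_norm//; lra.
Qed.

Global Instance is_derive_sinh x : is_derive x 1 (@sinh R) (cosh x).
Proof.
have -> : @sinh R = 2^-1 \*: (expR - (expR \o -%R)).
  by apply/funext => z; rewrite /sinh /= fctE mulrC.
apply: is_derive_eq; rewrite /cosh mulrN1 opprK mulrC //.
Qed.

Global Instance is_derive_cosh x : is_derive x 1 (@cosh R) (sinh x).
Proof.
have -> : @cosh R = 2^-1 \*: (expR + (expR \o -%R)).
  by apply/funext => z; rewrite /cosh /= fctE mulrC.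
apply: is_derive_eq; rewrite /sinh mulrN1 mulrC //.
Qed.

Global Instance is_derive_asinh x :
  is_derive x 1 asinh (Num.sqrt (1 + x ^+ 2))^-1.
Proof.
rewrite -cosh_asinh -{1}[x]asinhK.
apply: (@is_derive_inverse _ (@sinh R)); last by rewrite lt0r_neq0 ?cosh_gt0.
- by near=> z; exact: sinhK.
- near=> z; apply: differentiable_continuous.
  by apply/derivable1_diffP.
Unshelve. all: by end_near. Qed.

(** The rules of differentiation for functions given pointwise, with the derivative in the
   form that the computations below produce. *)
Lemma der_cst (c u : R) : is_derive u 1 (fun _ : R => c) 0.
Proof. exact: is_derive_cst. Qed.

Lemma der_id (u : R) : is_derive u 1 (fun v : R => v) 1.
Proof. exact: is_derive_id. Qed.

Lemma der_add (f g : R -> R) (u a b : R) : is_derive u 1 f a -> is_derive u 1 g b ->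
  is_derive u 1 (fun v => f v + g v) (a + b).
Proof. exact: is_deriveD. Qed.

Lemma der_sub (f g : R -> R) (u a b : R) : is_derive u 1 f a -> is_derive u 1 g b ->
  is_derive u 1 (fun v => f v - g v) (a - b).
Proof. exact: is_deriveB. Qed.

Lemma der_opp (f : R -> R) (u a : R) : is_derive u 1 f a ->
  is_derive u 1 (fun v => - f v) (- a).
Proof. exact: is_deriveN. Qed.

Lemma der_mul (f g : R -> R) (u a b : R) : is_derive u 1 f a -> is_derive u 1 g b ->
  is_derive u 1 (fun v => f v * g v) (a * g u + f u * b).
Proof.
by move=> fa gb; apply: (is_derive_eq (is_deriveM fa gb)); rewrite /GRing.scale/=; ring.
Qed.

Lemma der_comp (f g : R -> R) (u a b : R) :
  is_derive (g u) 1 f a -> is_derive u 1 g b ->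
  is_derive u 1 (fun v => f (g v)) (a * b).
Proof. exact: is_derive1_comp. Qed.

Lemma der_sum m (f : 'I_m -> R -> R) (a : 'I_m -> R) (u : R) :
  (forall i, is_derive u 1 (f i) (a i)) ->
  is_derive u 1 (fun v => \sum_i f i v) (\sum_i a i).
Proof.
move=> fa; have -> : (fun v => \sum_i f i v) = \sum_i f i.
  by apply/funext => v; rewrite fct_sumE.
exact: is_derive_sum.
Qed.

Lemma der_inv (f : R -> R) (u a : R) : f u != 0 -> is_derive u 1 f a ->
  is_derive u 1 (fun v => (f v)^-1) (- (f u) ^- 2 * a).
Proof. by move=> fu fa; apply: is_deriveV. Qed.

Lemma der_sqrt (f : R -> R) (u a : R) : 0 < f u -> is_derive u 1 f a ->
  is_derive u 1 (fun v => Num.sqrt (f v)) ((2 * Num.sqrt (f u))^-1 * a).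
Proof. by move=> fu fa; apply: (der_comp _ fa); exact: is_derive1_sqrt. Qed.

Lemma der_continuous (f : R -> R) (u a : R) : is_derive u 1 f a -> {for u, continuous f}.
Proof. by move=> [fa _]; apply: differentiable_continuous; exact/derivable1_diffP. Qed.

Lemma derivable_ndecr (f df : R -> R) a b : a <= b ->
  (forall x, is_derive x 1 f (df x)) -> (forall x, a <= x -> 0 <= df x) ->
  f a <= f b.
Proof.
move=> ab fd df0; apply: (@ger0_derive1_ndecr _ f a b) => //.
- move=> x; rewrite in_itv/= => /andP[ax _]; rewrite derive1E.
  by have [_ ->] := fd x; rewrite df0// ltW.
- apply: continuous_subspaceT => x; apply: differentiable_continuous.
  by apply/derivable1_diffP; have [] := fd x.
Qed.

Lemma sinh_scale k x : 1 <= k -> 0 <= x -> k * sinh x <= sinh (k * x).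
Proof.
move=> k1 x0.
have := @derivable_ndecr (fun y => sinh (k * y) - k * sinh y)
  (fun y => k * cosh (k * y) - k * cosh y) 0 x x0.
rewrite !mulr0 sinh0 mulr0 subrr subr_ge0; apply.
  move=> y.
  have -> : (fun y => sinh (k * y) - k * sinh y) = (@sinh R \o (k \*: id)) - k \*: (@sinh R) by [].
  by apply: is_derive_eq; rewrite /= /GRing.scale/= mulr1; ring.
move=> y y0; rewrite -mulrBr mulr_ge0//; first by lra.
by rewrite subr_ge0 ler_cosh_pos ?ler_peMl// mulr_ge0//; lra.
Qed.

Lemma sinh_gex x : 0 <= x -> x <= sinh x.
Proof.
move=> x0; have := @derivable_ndecr (fun y => sinh y - y) (fun y => cosh y - 1) 0 x x0.
rewrite sinh0 subrr subr_ge0; apply.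
by move=> y _; rewrite subr_ge0 cosh_ge1.
Qed.

(** The half-angle form of [cosh], the hyperbolic counterpart of a chord length. *)
Lemma coshB1 x : cosh x - 1 = 2 * sinh (x / 2) ^+ 2.
Proof.
have {1}-> : x = x / 2 + x / 2 by field.
by rewrite coshD -!expr2 cosh2E; ring.
Qed.

Lemma coshB1_ge x : x ^+ 2 <= 2 * (cosh x - 1).
Proof.
wlog x0 : x / 0 <= x.
  move=> h; case: (lerP 0 x) => [/h//|x0].
  by rewrite -sqrrN -coshN; apply: h; lra.
rewrite coshB1; have := @sinh_gex (x / 2); rewrite divr_ge0// => /(_ isT).
set t := sinh _; nra.
Qed.

(** By convexity of [sinh], lengthening a chord by [k >= 1] lengthens the hyperbolic
   distance of its ends at most by [k]. *)
Lemma coshB1_scale k x : 1 <= k -> 0 <= x ->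
  k ^+ 2 * (cosh x - 1) <= cosh (k * x) - 1.
Proof.
move=> k1 x0; rewrite !coshB1 mulrCA ler_pM2l// -exprMn.
have x20 : 0 <= x / 2 by rewrite divr_ge0.
rewrite ler_pXn2r// ?nnegrE.
- by rewrite -mulrA sinh_scale.
- by rewrite mulr_ge0 ?sinh_ge0//; lra.
- by rewrite sinh_ge0 -mulrA mulr_ge0//; lra.
Qed.

Lemma expR_le_quadratic x : `|x| <= 2^-1 -> expR x <= 1 + x + 2 * x ^+ 2.
Proof.
rewrite ler_norml => /andP[xl xu].
have e := expR_ge1Dx (- x); have m := expRMN x.
have p := expR_gt0 x; move: e m p; set a := expR x; set b := expR _.
move=> e m p.
have : a * (1 - x) <= 1 by rewrite -[leRHS]m ler_pM2l.
have : 1 <= (1 + x + 2 * x ^+ 2) * (1 - x) by nra.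
move=> h1 h2.
have : a * (1 - x) <= (1 + x + 2 * x ^+ 2) * (1 - x) by exact: le_trans h1.
by rewrite ler_pM2r//; lra.
Qed.

Lemma coshB1_le x : `|x| <= 2^-1 -> cosh x - 1 <= 2 * x ^+ 2.
Proof.
move=> h; have := expR_le_quadratic h; rewrite -normrN in h.
have := expR_le_quadratic h; rewrite /cosh sqrrN; lra.
Qed.

Lemma sinh_le_quadratic x : 0 <= x -> x <= 2^-1 -> sinh x <= x + x ^+ 2.
Proof.
move=> x0 x1; have h : `|x| <= 2^-1 by rewrite ger0_norm.
have := expR_le_quadratic h; have := expR_ge1Dx (- x).
rewrite /sinh; lra.
Qed.

End HyperbolicFunctions.

(** * Hausdorff measure *)

Section Hausdorff.
Context {R : realType}.
Local Open Scope ereal_scope.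

Lemma unit_ball_volume_gt0 k : (0 < unit_ball_volume k :> R)%R.
Proof.
suff : (0 < unit_ball_volume k :> R)%R /\ (0 < unit_ball_volume k.+1 :> R)%R by case.
elim: k => [|k [h1 h2]]; split => //=.
by rewrite mulr_gt0// divr_gt0// mulr_gt0// pi_gt0.
Qed.

Definition hausdorff_cst (k : nat) : R := (unit_ball_volume k / 2 ^+ k)%R.

Lemma hausdorff_cst_gt0 k : (0 < hausdorff_cst k)%R.
Proof. by rewrite divr_gt0 ?unit_ball_volume_gt0// exprn_gt0. Qed.

Section Premeasure.
Variables (T : Type) (d : T -> T -> R) (k : nat).
Implicit Types (E U : set T).

Lemma diameter_ge0 U : 0 <= diameter d U.
Proof. by apply: ereal_sup_ubound; left. Qed.

Lemma le_diameter U x y : U x -> U y -> (d x y)%:E <= diameter d U.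
Proof. by move=> Ux Uy; apply: ereal_sup_ubound; right; exists (x, y). Qed.

Lemma diameter_le U (r : R) : (0 <= r)%R ->
  (forall x y, U x -> U y -> (d x y <= r)%R) -> diameter d U <= r%:E.
Proof.
move=> r0 h; apply: ge_ereal_sup => _ [->|[[x y] [/= Ux Uy] <-]].
  by rewrite lee_fin.
by rewrite lee_fin h.
Qed.

(** Covers enter a lower bound only through real bounds [r i] on their diameters. *)
Lemma hausdorff_premeasure_ge delta E (B : \bar R) :
  (forall (U : nat -> set T) (r : nat -> R),
     (forall i, 0 <= r i <= delta)%R ->
     (forall i x y, U i x -> U i y -> (d x y <= r i)%R) ->
     E `<=` \bigcup_i U i ->
     B <= \sum_(i <oo) (hausdorff_cst k * r i ^+ k)%:E) ->
  B <= hausdorff_premeasure d k delta E.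
Proof.
move=> h; apply: le_ereal_inf_tmp => _ [U [dU EU] <-].
have fU i : diameter d (U i) \is a fin_num.
  by rewrite ge0_fin_numE ?diameter_ge0// (le_lt_trans (dU i))// ltry.
pose r i := fine (diameter d (U i)).
have rE i : diameter d (U i) = (r i)%:E by rewrite fineK.
rewrite (eq_eseriesr (g := fun i => (hausdorff_cst k * r i ^+ k)%:E)); last first.
  by move=> i _; rewrite rE -EFin_expe -EFinM.
apply: (h U) => //.
  by move=> i; rewrite -!lee_fin -rE diameter_ge0 dU.
by move=> i x y Ux Uy; rewrite -lee_fin -rE le_diameter.
Qed.

Lemma hausdorff_premeasure_le delta E (U : nat -> set T) (r : nat -> R) :
  (forall i, 0 <= r i <= delta)%R ->
  (forall i x y, U i x -> U i y -> (d x y <= r i)%R) ->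
  E `<=` \bigcup_i U i ->
  hausdorff_premeasure d k delta E <= \sum_(i <oo) (hausdorff_cst k * r i ^+ k)%:E.
Proof.
move=> r0 dU EU.
have dr i : diameter d (U i) <= (r i)%:E.
  by apply: diameter_le; [have /andP[] := r0 i|exact: dU].
apply: (@le_trans _ _ (\sum_(i <oo) (hausdorff_cst k)%:E * diameter d (U i) ^+ k)).
  apply: ereal_inf_lbound; exists U => //; split => // i.
  by rewrite (le_trans (dr i))// lee_fin; have /andP[] := r0 i.
have c0 := hausdorff_cst_gt0 k.
have dk i : 0 <= diameter d (U i) ^+ k by rewrite expe_ge0// diameter_ge0.
apply: lee_nneseries => [i _ _|i _].
  by rewrite mule_ge0// lee_fin ltW.
rewrite [leRHS]EFinM lee_wpmul2l ?lee_fin ?(ltW c0)//.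
have fU : diameter d (U i) \is a fin_num.
  by rewrite ge0_fin_numE ?diameter_ge0// (le_lt_trans (dr i))// ltry.
move: (dr i); rewrite -(fineK fU) -EFin_expe !lee_fin => h.
by rewrite lerXn2r ?nnegrE ?fine_ge0 ?diameter_ge0//; have /andP[] := r0 i.
Qed.

Lemma le_hausdorff_measure delta E : (0 < delta)%R ->
  hausdorff_premeasure d k delta E <= hausdorff_measure d k E.
Proof. by move=> d0; apply: ereal_sup_ubound; exists delta. Qed.

Lemma hausdorff_measure_le E (B : \bar R) :
  (forall delta, (0 < delta)%R -> hausdorff_premeasure d k delta E <= B) ->
  hausdorff_measure d k E <= B.
Proof. by move=> h; apply: ge_ereal_sup => _ [delta d0 <-]; exact: h. Qed.

Lemma hausdorff_measure_mono E F : E `<=` F ->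
  hausdorff_measure d k E <= hausdorff_measure d k F.
Proof.
move=> EF; apply: hausdorff_measure_le => delta d0.
apply: le_trans (le_hausdorff_measure _ d0).
apply: hausdorff_premeasure_ge => U r r0 dU FU.
by apply: (hausdorff_premeasure_le (U := U)) => //; exact: subset_trans FU.
Qed.

Lemma hausdorff_measure_le_finite_cover E (B : R) :
  (forall delta : R, (0 < delta)%R -> exists (J : finType) (W : J -> set T) (r : R),
     [/\ (0 <= r <= delta)%R,
         (forall j x y, W j x -> W j y -> (d x y <= r)%R),
         E `<=` \bigcup_j W j &
         (hausdorff_cst k * (#|J|%:R * r ^+ k) <= B)%R]) ->
  (0 < k)%N ->
  hausdorff_measure d k E <= B%:E.
Proof.
move=> h k0; apply: hausdorff_measure_le => delta d0.
have [J [W [r [/andP[r0 rd] dW EW cB]]]] := h _ d0.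
(* the sequence continues with empty sets of diameter 0 *)
pose U (i : nat) := oapp W set0 (nth None (map Some (enum J)) i).
pose ri (i : nat) : R := if (i < #|J|)%N then r else 0%R.
apply: (@le_trans _ _ (\sum_(i <oo) (hausdorff_cst k * ri i ^+ k)%:E)).
  apply: (@hausdorff_premeasure_le delta E U).
  - by move=> i; rewrite /ri; case: ifP => _; rewrite ?r0 ?rd// lexx ltW.
  - move=> i x y; rewrite /U /ri.
    case: (ltnP i #|J|) => iJ; last by rewrite nth_default// size_map -cardE.
    have [j _] : exists j : J, True by move: iJ; case: (enum J) (cardE J) => [->//|j *]; exists j.
    by rewrite (nth_map j) -?cardE//=; exact: dW.
  - move=> x /EW[j _ Wj]; exists (index j (enum J)) => //.
    rewrite /U (nth_map j) ?index_mem ?mem_enum//=.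
    by rewrite nth_index// mem_enum.
have c0 := hausdorff_cst_gt0 k.
have t0 i : 0 <= (hausdorff_cst k * ri i ^+ k)%:E.
  by rewrite lee_fin mulr_ge0 ?(ltW c0)// exprn_ge0// /ri; case: ifP.
rewrite (nneseries_split 0 #|J|)// add0n eseries0 ?adde0; last first.
  by move=> i iJ _; rewrite /ri ltnNge iJ/= expr0n gtn_eqF// mulr0.
rewrite (eq_big_nat _ _ (F2 := fun=> (hausdorff_cst k * r ^+ k)%:E)); last first.
  by move=> i /andP[_ iJ]; rewrite /ri iJ.
rewrite big_mkord sumEFin lee_fin sumr_const card_ord -[leLHS]mulr_natl.
by rewrite mulrCA.
Qed.

End Premeasure.

(** Since only fine covers matter, a Lipschitz bound at small distances is enough;
   [a] and [b] parametrize the two sets by a common index set. *)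
Lemma hausdorff_measure_lipschitz (T T' I : Type) (d : T -> T -> R)
    (d' : T' -> T' -> R) (a : I -> T) (b : I -> T') (D : set I) (K delta0 : R) k :
  (0 < K)%R -> (0 < delta0)%R ->
  (forall i j, D i -> D j -> (d (a i) (a j) < delta0)%R ->
     (d' (b i) (b j) <= K * d (a i) (a j))%R) ->
  hausdorff_measure d' k (b @` D) <= (K ^+ k)%:E * hausdorff_measure d k (a @` D).
Proof.
move=> K0 delta00 lip; apply: hausdorff_measure_le => delta d0.
pose e := Num.min (delta0 / 2)%R (delta / K)%R.
have e0 : (0 < e)%R by rewrite lt_min !divr_gt0.
have Kk0 : (0 < K ^+ k)%R by rewrite exprn_gt0.
apply: (@le_trans _ _ ((K ^+ k)%:E * hausdorff_premeasure d k e (a @` D))); last first.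
  by rewrite lee_wpmul2l ?lee_fin ?(ltW Kk0)// le_hausdorff_measure.
rewrite -lee_pdivrMl//; apply: hausdorff_premeasure_ge => U r r0 dU DU.
rewrite lee_pdivrMl//.
pose V i := b @` [set x | D x /\ U i (a x)].
apply: (@le_trans _ _ (\sum_(i <oo) (hausdorff_cst k * (K * r i) ^+ k)%:E)).
  apply: (@hausdorff_premeasure_le _ _ _ _ _ V).
  - move=> i; have /andP[ri0] := r0 i; rewrite le_min => /andP[_ h].
    by rewrite mulr_ge0 ?(ltW K0)//= mulrC -ler_pdivlMr.
  - move=> i _ _ [x [Dx Ux] <-] [y [Dy Uy] <-].
    have xy := dU i _ _ Ux Uy.
    apply: (@le_trans _ _ (K * d (a x) (a y))%R); last by rewrite ler_pM2l.
    apply: lip => //; apply: le_lt_trans xy _.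
    have /andP[ri0] := r0 i; rewrite le_min => /andP[h _].
    by apply: le_lt_trans h _; lra.
  - move=> _ [x Dx <-]; have [i _ Ui] := DU (a x) (imageP _ Dx).
    by exists i => //; exists x.
rewrite -nneseriesZl; last first.
  move=> i _; have /andP[ri0 _] := r0 i.
  by rewrite lee_fin mulr_ge0 ?(ltW (hausdorff_cst_gt0 k))// exprn_ge0.
apply: lee_nneseries => [i _ _|i _].
  have /andP[ri0 _] := r0 i.
  rewrite lee_fin mulr_ge0 ?(ltW (hausdorff_cst_gt0 k))// exprn_ge0//.
  by rewrite mulr_ge0 ?(ltW K0).
by rewrite -EFinM lee_fin exprMn mulrCA.
Qed.

(** Integrating the inequality [1 <= sum of indicators] over one coordinate after
   the other turns each indicator into a side length. *)
Lemma box_cover n (lo hi : nat -> nat -> R) :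
  (forall i j, lo i j <= hi i j)%R ->
  (forall x : nat -> R, (forall j, 0 <= x j <= 1)%R ->
     exists i, forall j, (j < n)%N -> (lo i j <= x j <= hi i j)%R) ->
  1 <= \sum_(i <oo) (\prod_(0 <= j < n) (hi i j - lo i j))%:E.
Proof.
move=> lohi cov.
pose I i j : set R := `[lo i j, hi i j]%classic.
pose A k i : R := (\prod_(0 <= j < k) (hi i j - lo i j))%R.
pose B k i (x : nat -> R) : R := (\prod_(k <= j < n) \1_(I i j) (x j))%R.
have A0 k i : (0 <= A k i)%R by apply: prodr_ge0 => j _; rewrite subr_ge0.
have B0 k i x : (0 <= B k i x)%R by apply: prodr_ge0 => j _; rewrite indicE.
suff H k : (k <= n)%N -> forall x : nat -> R, (forall j, 0 <= x j <= 1)%R ->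
    1 <= \sum_(i <oo) (A k i * B k i x)%:E.
  have := H n (leqnn n) (fun=> 0%R); rewrite /B => /(_ _)/le_trans; apply.
    by move=> _; rewrite lexx ler01.
  by apply: lee_nneseries => i *; rewrite /index_iota subnn big_nil mulr1 ?lee_fin.
elim: k => [_ x x01|k IH kn x x01].
  have [i hi0] := cov x x01.
  apply: le_trans (nneseries_lim_ge i.+1 _); last first.
    by move=> j _ _; rewrite lee_fin mulr_ge0.
  rewrite big_nat_recr//= -[leLHS]add0e leeD//.
    by rewrite sume_ge0// => j _; rewrite lee_fin mulr_ge0.
  rewrite /A big_nil mul1r /B big_nat big1 // => j /andP[_ jn].
  by rewrite indicE mem_set// /I /= in_itv/= hi0.
pose upd t : nat -> R := fun j => if j == k then t else x j.
have up01 t : (0 <= t <= 1)%R -> forall j, (0 <= upd t j <= 1)%R.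
  by move=> t01 j; rewrite /upd; case: ifP.
have E t i : (A k i * B k i (upd t) = (A k i * B k.+1 i x) * \1_(I i k) t)%R.
  rewrite /B big_ltn// {1}/upd eqxx -mulrA; congr (_ * _)%R; rewrite mulrC.
  congr (_ * _)%R; apply: eq_big_nat => j /andP[kj _].
  by rewrite /upd gtn_eqF.
pose mu := @lebesgue_measure R.
have mI i : measurable (I i k) by exact: measurable_itv.
have m01 : measurable (`[0%R, 1%R]%classic : set R) by exact: measurable_itv.
have mf i : measurable_fun (`[0%R, 1%R]%classic : set R)
    (fun t : R => A k i * B k.+1 i x * \1_(I i k) t)%R.
  apply: measurable_funM; first exact: measurable_cst.
  exact: measurable_indic.
have mF i : measurable_fun (`[0%R, 1%R]%classic : set R)
    (fun t : R => (A k i * B k.+1 i x * \1_(I i k) t)%:E).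
  by apply/measurable_EFinP; exact: mf.
have mind i : measurable_fun (`[0%R, 1%R]%classic : set R)
    (fun t : R => (\1_(I i k) t)%:E : \bar R).
  by apply/measurable_EFinP; exact: measurable_indic.
have -> : 1 = \int[mu]_(t in `[0%R, 1%R]) (cst 1%E) t :> \bar R.
  by rewrite integral_cst//= mul1e lebesgue_measure_itv/= lte_fin ltr01 oppr0 adde0.
apply: (@le_trans _ _ (\int[mu]_(t in `[0%R, 1%R])
    (\sum_(i <oo) (A k i * B k.+1 i x * \1_(I i k) t)%:E))).
  apply: ge0_le_integral => //.
  - apply: ge0_emeasurable_sum => [i t _ _|i _]; last exact: mF.
    by rewrite lee_fin !mulr_ge0// indicE.
  - move=> t /=; rewrite in_itv/= => t01.
    under eq_eseriesr do rewrite -E.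
    by apply: IH; [exact: ltnW|exact: up01].
rewrite integral_nneseries//; last by move=> i t _; rewrite lee_fin !mulr_ge0// indicE.
apply: lee_nneseries => [i _ _|i _].
  by apply: integral_ge0 => t _; rewrite lee_fin !mulr_ge0// indicE.
under eq_integral do rewrite EFinM.
rewrite ge0_integralZl_EFin//; [|exact: mind|by rewrite mulr_ge0].
rewrite integral_indic//; last exact: mI.
have -> : (A k.+1 i * B k.+1 i x)%:E = (A k i * B k.+1 i x)%:E * (hi i k - lo i k)%:E.
  by rewrite -EFinM /A big_nat_recr//= mulrAC.
rewrite lee_wpmul2l ?lee_fin ?mulr_ge0//.
apply: (@le_trans _ _ (mu (I i k))).
  apply: le_measure; rewrite ?inE//; last exact: mI.
  by apply: measurableI; [exact: mI|exact: m01].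
rewrite /mu /I lebesgue_measure_itv/= lte_fin.
by case: ifPn => [_|_]; rewrite ?EFinB// lee_fin subr_ge0.
Qed.

(** A set that a Lipschitz map sends onto the unit cube has Hausdorff measure bounded
   below: a piece of diameter [r] lands in a box of side [2 K r]. *)
Lemma hausdorff_measure_ge_cube (T I : Type) (d : T -> T -> R) (a : I -> T)
    (D : set I) (f : I -> nat -> R) (K delta0 : R) k :
  (0 < K)%R -> (0 < delta0)%R ->
  (forall i j, D i -> D j -> (d (a i) (a j) < delta0)%R ->
     forall m, (m < k)%N -> (`|f i m - f j m| <= K * d (a i) (a j))%R) ->
  (forall x : nat -> R, (forall m, 0 <= x m <= 1)%R ->
     exists2 i, D i & forall m, (m < k)%N -> f i m = x m) ->
  (hausdorff_cst k / (2 * K) ^+ k)%:E <= hausdorff_measure d k (a @` D).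
Proof.
move=> K0 d0 lip sur.
have d20 : (0 < delta0 / 2)%R by rewrite divr_gt0.
apply: le_trans (le_hausdorff_measure _ _ _ d20).
apply: hausdorff_premeasure_ge => U r r0 dU DU.
have /choice[c cP] : forall i, exists o : option I,
    match o with
    | Some z => D z /\ U i (a z)
    | None => forall z, D z -> ~ U i (a z)
    end.
  move=> i.
  have [[z Dz Uz]|h] := pselect (exists2 z, D z & U i (a z)); first by exists (Some z).
  by exists None => z Dz Uz; apply: h; exists z.
(* a member of the cover that misses [a @` D] gets the degenerate box at the origin *)
pose lo i j : R := if c i is Some z then (f z j - K * r i)%R else 0%R.
pose hi i j : R := if c i is Some z then (f z j + K * r i)%R else 0%R.
have Kr i : (0 <= K * r i)%R by have /andP[? _] := r0 i; rewrite mulr_ge0 ?(ltW K0).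
have lohi i j : (lo i j <= hi i j)%R.
  by rewrite /hi /lo; have := Kr i; case: (c i) => [z|]; lra.
suff cov x : (forall j : nat, 0 <= x j <= 1)%R ->
    exists i, forall j, (j < k)%N -> (lo i j <= x j <= hi i j)%R.
  have := box_cover lohi cov.
  have ck := hausdorff_cst_gt0 k.
  have K2k : (0 < (2 * K) ^+ k)%R by rewrite exprn_gt0// mulr_gt0.
  move=> h.
  rewrite mulrC EFinM lee_pdivrMl// -nneseriesZl; last first.
    by move=> i _; have /andP[? _] := r0 i; rewrite lee_fin mulr_ge0 ?(ltW ck)// exprn_ge0.
  rewrite -[leLHS]mule1 -lee_pdivlMl// -nneseriesZl; last first.
    move=> i _; have /andP[? _] := r0 i.
    rewrite mule_ge0// lee_fin ?(ltW K2k)//.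
    by rewrite mulr_ge0 ?(ltW ck)// exprn_ge0.
  apply: (le_trans h); apply: lee_nneseries => [i _ _|i _].
    rewrite lee_fin prodr_ge0// => j _; rewrite /hi /lo; case: (c i) => [z|]; last by rewrite subrr.
    by have := Kr i; lra.
  rewrite -!EFinM lee_fin mulrCA mulKf ?lt0r_neq0// -exprMn.
  have /andP[ri0 _] := r0 i.
  rewrite big_mkord; apply: (@le_trans _ _ (\prod_(j < k) (2 * K * r i))%R).
    apply: ler_prod => j _; rewrite /hi /lo; have := Kr i.
    by case: (c i) => [z|]; lra.
  by rewrite prodr_const card_ord.
move=> x01; have [z Dz fz] := sur x x01.
have [i _ Ui] := DU (a z) (imageP _ Dz).
exists i => j jk; rewrite /lo /hi.
move: (cP i); case: (c i) => [w [Dw Uw]|/(_ z Dz)//].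
have wz := dU i _ _ Uw Ui.
have /andP[ri0 rid] := r0 i.
have lt0 : (d (a w) (a z) < delta0)%R by apply: le_lt_trans wz _; lra.
have := lip w z Dw Dz lt0 j jk; rewrite fz// => h.
have : (`|f w j - x j| <= K * r i)%R by rewrite (le_trans h)// ler_pM2l.
by rewrite ler_norml => /andP[]; lra.
Qed.

End Hausdorff.

(** * The hyperboloid model in Fermi coordinates *)

Section Euclid.
Context {R : realType}.
Variable m : nat.
Implicit Types u v w : 'rV[R]_m.

Lemma dotC u v : dot u v = dot v u.
Proof. by apply: eq_bigr => i _; rewrite mulrC. Qed.

Lemma dotDl u v w : dot (u + v) w = dot u w + dot v w.
Proof. by rewrite -big_split; apply: eq_bigr => i _; rewrite mxE mulrDl. Qed.

Lemma dotZl (a : R) u v : dot (a *: u) v = a * dot u v.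
Proof. by rewrite mulr_sumr; apply: eq_bigr => i _; rewrite mxE mulrA. Qed.

Lemma dotDr u v w : dot w (u + v) = dot w u + dot w v.
Proof. by rewrite dotC dotDl !(dotC w). Qed.

Lemma dotZr (a : R) u v : dot v (a *: u) = a * dot v u.
Proof. by rewrite dotC dotZl dotC. Qed.

Lemma dotNl u v : dot (- u) v = - dot u v.
Proof. by rewrite -scaleN1r dotZl mulN1r. Qed.

Lemma dotNr u v : dot v (- u) = - dot v u.
Proof. by rewrite dotC dotNl dotC. Qed.

Lemma dot0l v : dot 0 v = 0.
Proof. by rewrite -(scale0r v) dotZl mul0r. Qed.

Lemma dot0r v : dot v 0 = 0.
Proof. by rewrite dotC dot0l. Qed.

Definition dotE := (dotDl, dotDr, dotZl, dotZr, dotNl, dotNr).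

Lemma dot_ge0 v : 0 <= dot v v.
Proof. by apply: sumr_ge0 => i _; rewrite -expr2 sqr_ge0. Qed.

Lemma coord_le_dot v i : v 0 i ^+ 2 <= dot v v.
Proof.
rewrite /dot (bigD1 i)//= -expr2 lerDl; apply: sumr_ge0 => j _.
by rewrite -expr2 sqr_ge0.
Qed.

Lemma dot_eq0 v : (dot v v == 0) = (v == 0).
Proof.
apply/eqP/eqP => [v0|->]; last by rewrite dot0l.
apply/rowP => i; rewrite mxE; apply/eqP; rewrite -sqrf_eq0 eq_le sqr_ge0 andbT.
by rewrite -v0 coord_le_dot.
Qed.

Lemma dot_gt0 v : v != 0 -> 0 < dot v v.
Proof. by move=> v0; rewrite lt_neqAle dot_ge0 eq_sym dot_eq0 v0. Qed.

Lemma enorm_ge0 v : 0 <= enorm v.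
Proof. exact: sqrtr_ge0. Qed.

Lemma enorm_sqr v : enorm v ^+ 2 = dot v v.
Proof. by rewrite sqr_sqrtr// dot_ge0. Qed.

Lemma enorm_eq0 v : (enorm v == 0) = (v == 0).
Proof. by rewrite -sqrf_eq0 enorm_sqr dot_eq0. Qed.

Lemma enorm_gt0 v : v != 0 -> 0 < enorm v.
Proof. by move=> v0; rewrite lt_neqAle enorm_ge0 eq_sym enorm_eq0 v0. Qed.

Lemma enormZ (a : R) v : enorm (a *: v) = `|a| * enorm v.
Proof. by rewrite /enorm dotZl dotZr mulrA -expr2 sqrtrM ?sqr_ge0// sqrtr_sqr. Qed.

Lemma enorm0 : enorm (0 : 'rV[R]_m) = 0.
Proof. by apply/eqP; rewrite enorm_eq0. Qed.

Lemma dot_cauchy_schwarz u v : dot u v ^+ 2 <= dot u u * dot v v.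
Proof.
have [->|v0] := eqVneq v 0; first by rewrite !dot0r expr0n mulr0.
have := dot_ge0 (dot v v *: u - dot u v *: v).
rewrite !dotE (dotC v u) => h.
have := dot_gt0 v0; move: h.
set a := dot u u; set b := dot u v; set c := dot v v => h c0.
have : 0 <= c * (a * c - b ^+ 2) by apply: le_trans h _; rewrite le_eqVlt; apply/orP; left; apply/eqP; ring.
by rewrite pmulr_rge0// subr_ge0.
Qed.

Lemma dot_le_enorm u v : dot u v <= enorm u * enorm v.
Proof.
apply: (le_trans (ler_norm _)).
rewrite -(@ler_pXn2r _ 2)// ?nnegrE ?mulr_ge0 ?enorm_ge0//.
by rewrite real_normK ?num_real// exprMn !enorm_sqr dot_cauchy_schwarz.
Qed.

End Euclid.

Section Minkowski.
Context {R : realType}.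
Variable n : nat.

(** Vectors of the Minkowski space of signature [(-, +, ..., +)] with one time
   coordinate, one coordinate along the circle, and [n] more. *)
Definition mink := (R * R * 'rV[R]_n)%type.
Implicit Types A B P Q N V : mink.

Definition eta A B : R := - (A.1.1 * B.1.1) + A.1.2 * B.1.2 + dot A.2 B.2.

Definition lincomb (a : R) A (b : R) B : mink :=
  (a * A.1.1 + b * B.1.1, a * A.1.2 + b * B.1.2, a *: A.2 + b *: B.2).

Lemma etaC A B : eta A B = eta B A.
Proof. by rewrite /eta dotC; ring. Qed.

Lemma eta_lcl a A b B V : eta (lincomb a A b B) V = a * eta A V + b * eta B V.
Proof. by rewrite /eta /lincomb /= !dotE; ring. Qed.

Lemma eta_lcr a A b B V : eta V (lincomb a A b B) = a * eta V A + b * eta V B.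
Proof. by rewrite etaC eta_lcl !(etaC V). Qed.

(** Unit timelike vectors of the future: the hyperboloid model of hyperbolic space. *)
Definition hyperboloid Q := eta Q Q = -1 /\ 0 < Q.1.1.

Lemma hyperboloid_sqr Q : hyperboloid Q ->
  Q.1.1 ^+ 2 = 1 + Q.1.2 ^+ 2 + dot Q.2 Q.2.
Proof. by move=> [h _]; move: h; rewrite /eta; lra. Qed.

(** The orthogonal of a timelike vector is spacelike, since there
   [A0 Q0 = A1 Q1 + AY . QY] and [Q0 ^ 2 = 1 + Q1 ^ 2 + |QY| ^ 2]. *)
Lemma tangent_bound Q A : hyperboloid Q -> eta A Q = 0 ->
  A.1.2 ^+ 2 + dot A.2 A.2 <= Q.1.1 ^+ 2 * eta A A.
Proof.
move=> hQ AQ; have sQ := hyperboloid_sqr hQ.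
have cs := dot_cauchy_schwarz A.2 Q.2.
have a0 := dot_ge0 A.2; have q0 := dot_ge0 Q.2.
have e : A.1.1 * Q.1.1 = A.1.2 * Q.1.2 + dot A.2 Q.2 by move: AQ; rewrite /eta; lra.
have -> : Q.1.1 ^+ 2 * eta A A = (A.1.2 ^+ 2 + dot A.2 A.2) * Q.1.1 ^+ 2 - (A.1.1 * Q.1.1) ^+ 2.
  by rewrite /eta; ring.
rewrite e sQ.
move: cs a0 q0; set a := dot A.2 A.2; set q := dot Q.2 Q.2; set b := dot A.2 Q.2.
set a1 := A.1.2; set q1 := Q.1.2 => cs a0 q0.
suff : (a1 * q1 + b) ^+ 2 <= (a1 ^+ 2 + a) * (q1 ^+ 2 + q) by lra.
suff : 2 * (a1 * q1 * b) <= a1 ^+ 2 * q + a * q1 ^+ 2 by lra.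
apply: (le_trans (ler_norm _)).
rewrite -(@ler_pXn2r _ 2)// ?nnegrE; last first.
  by rewrite addr_ge0// mulr_ge0// sqr_ge0.
rewrite real_normK ?num_real//.
have h : (a1 * q1) ^+ 2 * b ^+ 2 <= (a1 * q1) ^+ 2 * (a * q).
  by rewrite ler_wpM2l ?sqr_ge0.
have := sqr_ge0 (a1 ^+ 2 * q - a * q1 ^+ 2).
lra.
Qed.

Lemma tangent_ge0 Q A : hyperboloid Q -> eta A Q = 0 -> 0 <= eta A A.
Proof.
move=> hQ AQ; have := tangent_bound hQ AQ.
have Q0 : 0 < Q.1.1 ^+ 2 by rewrite exprn_gt0//; case: hQ.
have := dot_ge0 A.2; have := sqr_ge0 A.1.2.
by move=> h1 h2 h3; rewrite -(pmulr_rge0 _ Q0) (le_trans _ h3)// addr_ge0.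
Qed.

Lemma tangent_eq0 Q A : hyperboloid Q -> eta A Q = 0 -> eta A A = 0 ->
  A = (0, 0, 0).
Proof.
move=> hQ AQ AA; have := tangent_bound hQ AQ; rewrite AA mulr0 => h.
have h1 := sqr_ge0 A.1.2; have h2 := dot_ge0 A.2.
have e1 : A.1.2 = 0 by apply/eqP; rewrite -sqrf_eq0; apply/eqP; lra.
have e2 : A.2 = 0 by apply/eqP; rewrite -dot_eq0; apply/eqP; lra.
have e0 : A.1.1 = 0.
  apply/eqP; rewrite -sqrf_eq0; move: AA; rewrite /eta e1 e2 dot0l.
  by move=> h0; apply/eqP; lra.
by move: e0 e1 e2; case: A {AQ AA h h1 h2} => [[a b] c] /= -> -> ->.
Qed.

Lemma tangent_cauchy_schwarz Q A B : hyperboloid Q -> eta A Q = 0 -> eta B Q = 0 ->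
  eta A B ^+ 2 <= eta A A * eta B B.
Proof.
move=> hQ AQ BQ.
have B0 := tangent_ge0 hQ BQ.
have [BB|BB] := eqVneq (eta B B) 0.
  have -> : eta A B = 0 by rewrite (tangent_eq0 hQ BQ BB) /eta /= dot0r; ring.
  by rewrite BB expr0n mulr0.
have Bp : 0 < eta B B by rewrite lt_neqAle eq_sym BB.
have := @tangent_ge0 Q (lincomb (eta B B) A (- eta A B) B) hQ.
rewrite !eta_lcl !eta_lcr AQ BQ !mulr0 addr0 => /(_ erefl).
rewrite (etaC B A); move: Bp; set a := eta A A; set b := eta A B; set c := eta B B.
move=> c0 h.
have : 0 <= c * (a * c - b ^+ 2) by move: h; lra.
by rewrite pmulr_rge0// subr_ge0.
Qed.

(** The signed distance to the hyperplane orthogonal to a unit spacelike vector [N],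
   which is [asinh (eta N Q)], is 1-Lipschitz: this bounds its differential. *)
Lemma calibration_bound Q A N : hyperboloid Q -> eta A Q = 0 -> eta N N = 1 ->
  eta N A ^+ 2 <= (1 + eta N Q ^+ 2) * eta A A.
Proof.
move=> hQ AQ NN; have [QQ _] := hQ.
pose M := lincomb 1 N (eta N Q) Q.
have MQ : eta M Q = 0 by rewrite eta_lcl QQ; ring.
have MA : eta M A = eta N A by rewrite eta_lcl (etaC Q) AQ; ring.
have MM : eta M M = 1 + eta N Q ^+ 2.
  by rewrite !eta_lcl !eta_lcr QQ NN (etaC Q N); ring.
by rewrite -MA -MM; exact: (tangent_cauchy_schwarz hQ MQ AQ).
Qed.

Lemma eta_sub P Q : hyperboloid P -> hyperboloid Q ->
  eta (lincomb 1 P (-1) Q) (lincomb 1 P (-1) Q) = 2 * (- eta P Q - 1).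
Proof.
by move=> [PP _] [QQ _]; rewrite !eta_lcl !eta_lcr PP QQ (etaC Q P); ring.
Qed.

End Minkowski.
Arguments mink R n : clear implicits.

Section Lift.
Context {R : realType}.
Variable n : nat.
Implicit Types (x : 'rV[R]_n) (th r : R).

Definition sinhc r : R := if r == 0 then 1 else sinh r / r.

Lemma sinhcM r : sinhc r * r = sinh r.
Proof.
rewrite /sinhc; case: eqVneq => [->|r0]; first by rewrite mulr0 sinh0.
by rewrite divfK.
Qed.

(** The point of the hyperboloid with Fermi coordinates [(x, th)] along the axis
   [x = 0], where [x] is read in polar coordinates as in [gplus]. *)
Definition hpt x th : mink R n :=
  (cosh (enorm x) * cosh th, cosh (enorm x) * sinh th, sinhc (enorm x) *: x).

Lemma dot_hpt2 x : dot (sinhc (enorm x) *: x) (sinhc (enorm x) *: x) = sinh (enorm x) ^+ 2.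
Proof. by rewrite !dotE -enorm_sqr -sinhcM; ring. Qed.

Lemma hpt_hyperboloid x th : hyperboloid (hpt x th).
Proof.
split; last by rewrite mulr_gt0// cosh_gt0.
rewrite /eta /= dot_hpt2.
have := cosh2E (enorm x); have := cosh2E th; set a := cosh _; set b := cosh _.
move=> ha hb; have -> : - (b * a * (b * a)) = - (b ^+ 2 * a ^+ 2) by ring.
rewrite ha hb; have -> : b * sinh th * (b * sinh th) = b ^+ 2 * sinh th ^+ 2 by ring.
by rewrite hb; ring.
Qed.

Lemma eta_hpt x th x' th' : - eta (hpt x th) (hpt x' th') =
  cosh (enorm x) * cosh (enorm x') * cosh (th - th') -
  dot (sinhc (enorm x) *: x) (sinhc (enorm x') *: x').
Proof. by rewrite /eta /= coshB; ring. Qed.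

(** The nearest point projection to the axis, which is [th], does not increase distances. *)
Lemma cosh_le_eta_hpt x th x' th' :
  cosh (th - th') <= - eta (hpt x th) (hpt x' th').
Proof.
rewrite eta_hpt.
have h1 := dot_le_enorm (sinhc (enorm x) *: x) (sinhc (enorm x') *: x').
have h2 y : enorm (sinhc (enorm y : R) *: (y : 'rV[R]_n)) = sinh (enorm y).
  rewrite /enorm dot_hpt2 sqrtr_sqr ger0_norm// sinh_ge0; exact: enorm_ge0.
move: h1; rewrite !h2 => h1.
have h3 := cosh_ge1 (enorm x - enorm x'); rewrite coshB in h3.
have h4 := cosh_ge1 (th - th'); have := cosh_ge1 (enorm x); have := cosh_ge1 (enorm x').
move: h1 h3 h4; set a := cosh (enorm x); set b := cosh (enorm x').
set c := cosh (th - th'); set d := dot _ _; set s := sinh _ * sinh _ => h1 h3 h4 hb ha.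
have : 1 * (c - 1) <= a * b * (c - 1).
  by rewrite ler_wpM2r ?subr_ge0// mulr_ege1.
lra.
Qed.

Lemma eta_hpt_ge1 x th x' th' : 1 <= - eta (hpt x th) (hpt x' th').
Proof. exact: le_trans (cosh_ge1 _) (cosh_le_eta_hpt _ _ _ _). Qed.

Lemma sinhc_scale (t : R) (w : 'rV[R]_n) : enorm w = 1 \/ w = 0 ->
  sinhc (enorm (t *: w)) *: (t *: w) = sinh t *: w.
Proof.
case=> [w1|->]; last by rewrite !scaler0.
rewrite enormZ w1 mulr1 scalerA; congr (_ *: _).
case: (ger0P t) => _; first exact: sinhcM.
by rewrite -[RHS]opprK -sinhN -sinhcM mulrN opprK.
Qed.

Definition hcoord_th (V : mink R n) : R := asinh (V.1.2 / Num.sqrt (1 + dot V.2 V.2)).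
Definition hcoord_x (V : mink R n) : 'rV[R]_n := asinh (enorm V.2) *: ((enorm V.2)^-1 *: V.2).

Lemma hpt_polar (t : R) (w : 'rV[R]_n) (V : mink R n) :
  hyperboloid V -> enorm w = 1 \/ w = 0 -> V.2 = sinh t *: w ->
  hpt (t *: w) (hcoord_th V) = V.
Proof.
move=> hV w1 V2; rewrite /hpt sinhc_scale// -V2.
have C : cosh (enorm (t *: w)) = Num.sqrt (1 + dot V.2 V.2).
  have := dot_hpt2 (t *: w); rewrite sinhc_scale// -V2 => ->.
  by rewrite -cosh2E sqrtr_sqr ger0_norm// ltW// cosh_gt0.
have p : 0 < 1 + dot V.2 V.2 by have := dot_ge0 V.2; lra.
have q : 0 < Num.sqrt (1 + dot V.2 V.2) by rewrite sqrtr_gt0.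
have s : Num.sqrt (1 + dot V.2 V.2) ^+ 2 = 1 + dot V.2 V.2 by rewrite sqr_sqrtr// ltW.
rewrite C /hcoord_th asinhK; case: V hV {V2 C} p q s => [[a b] c] hV /=.
set k := Num.sqrt (1 + dot c c) => p q s.
have -> : k * (b / k) = b by field; rewrite gt_eqF.
congr (_, _, _).
have a0 : 0 < a by case: hV.
have := hyperboloid_sqr hV => /= ha.
apply/eqP; rewrite -(@eqrXn2 _ 2)// ?mulr_ge0 ?(ltW q) ?(ltW a0) ?(ltW (cosh_gt0 _))//.
rewrite exprMn cosh2E asinhK ha s; apply/eqP.
rewrite exprMn mulrDr mulr1 mulrCA exprVn s divff ?gt_eqF//; ring.
Qed.

Lemma hpt_surj (V : mink R n) : hyperboloid V -> hpt (hcoord_x V) (hcoord_th V) = V.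
Proof.
move=> hV; apply: hpt_polar => //; last first.
  rewrite asinhK scalerA; have [->|h] := eqVneq V.2 0; first by rewrite scaler0.
  by rewrite divff ?scale1r// enorm_eq0.
have [->|h] := eqVneq V.2 0; [by right; rewrite scaler0|left].
by rewrite enormZ normrV ?unitfE ?enorm_eq0// ger0_norm ?enorm_ge0// mulVf// enorm_eq0.
Qed.

Lemma hcoordK x th : hcoord_x (hpt x th) = x /\ hcoord_th (hpt x th) = th.
Proof.
split; last first.
  rewrite /hcoord_th /= dot_hpt2 -cosh2E sqrtr_sqr ger0_norm ?ltW ?cosh_gt0//.
  by rewrite mulrAC divff ?mul1r ?sinhK// gt_eqF// cosh_gt0.
rewrite /hcoord_x /=.
have -> : enorm (sinhc (enorm x) *: x) = sinh (enorm x).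
  by rewrite {1}/enorm dot_hpt2 sqrtr_sqr ger0_norm// sinh_ge0 enorm_ge0.
rewrite sinhK; have [->|x0] := eqVneq x 0; first by rewrite !scaler0.
rewrite !scalerA /sinhc enorm_eq0 (negbTE x0).
have e0 := enorm_gt0 x0; have s0 : 0 < sinh (enorm x) by rewrite sinh_gt0.
have -> : enorm x * (sinh (enorm x))^-1 * (sinh (enorm x) / enorm x) = 1.
  by field; rewrite !gt_eqF.
by rewrite scale1r.
Qed.

(** The slab [|th| <= M] of Fermi coordinates is a cone in Minkowski space. A cone that is
   narrower by the factor [rho < 1] stays at a definite distance from the two walls. *)
Lemma slab_bound x th (M rho : R) : 0 <= M -> 0 <= rho -> rho <= 1 ->
  cosh M * `|(hpt x th).1.2| <= rho * (sinh M * (hpt x th).1.1) ->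
  `|th| <= M - asinh ((1 - rho) * sinh M).
Proof.
move=> M0 r0 r1 /=; set c := cosh (enorm x).
have c0 : 0 < c by rewrite cosh_gt0.
rewrite normrM (gtr0_norm c0).
rewrite norm_sinh -(cosh_norm th); set t := `|th| => h.
have h1 : cosh M * sinh t <= rho * (sinh M * cosh t).
  by rewrite -(ler_pM2l c0); lra.
rewrite lerBrDr addrC -lerBrDr -ler_sinh asinhK sinhB.
have s0 : 0 <= sinh M by rewrite sinh_ge0.
have : (1 - rho) * sinh M * 1 <= (1 - rho) * sinh M * cosh t.
  by rewrite ler_wpM2l ?cosh_ge1// mulr_ge0// subr_ge0.
lra.
Qed.

Lemma slab_cone x th (M : R) : `|th| <= M ->
  cosh M * `|(hpt x th).1.2| <= sinh M * (hpt x th).1.1.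
Proof.
move=> h /=; set c := cosh (enorm x).
have c0 : 0 < c by rewrite cosh_gt0.
rewrite normrM (gtr0_norm c0).
rewrite norm_sinh -(cosh_norm th) mulrCA [leRHS]mulrCA ler_pM2l// -subr_ge0 -sinhB.
by rewrite sinh_ge0 subr_ge0.
Qed.

End Lift.

(** * The metric as the pull-back of the Minkowski form *)

Section Curves.
Context {R : realType}.

(** A function squeezed between [0] and a function with a critical zero is itself
   critical there; this handles the origin of polar coordinates, where [enorm] is not
   differentiable. *)
Lemma der_flat (f h : R -> R) (u : R) : h u = 0 -> is_derive u 1 h 0 ->
  (\forall t \near u, `|f t| <= h t) -> is_derive u 1 f 0.
Proof.
move=> hu [hd h0] fh.
have fu : f u = 0.
  by apply/eqP; rewrite -normr_le0 -hu; exact: (nbhs_singleton fh).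
suff H : (fun e : R => e^-1 *: ((f \o shift u) (e *: 1) - f u)) @ 0^' --> (0 : R).
  by apply: DeriveDef; [apply/cvg_ex; exists 0|exact: cvg_lim].
have /cvgr0Pnorm_lt hq : (fun e : R => e^-1 *: ((h \o shift u) (e *: 1) - h u)) @ 0^' --> (0 : R).
  by rewrite -[X in _ --> X]h0; exact: hd.
have [d /= d0 dP] := fh.
apply/cvgr0Pnorm_lt => eps eps0; near=> e.
have ed : `|e| < d by near: e; exact: dnbhs0_lt.
have he : `|f (e *: 1 + u)| <= h (e *: 1 + u).
  apply: dP; rewrite /ball_ /=.
  have -> : u - (e *: 1 + u) = - e by rewrite /GRing.scale/= mulr1; ring.
  by rewrite normrN.
apply: (@le_lt_trans _ _ `|e^-1 *: ((h \o shift u) (e *: 1) - h u)|).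
  rewrite fu hu !subr0 /= !normrM ler_wpM2l//.
  by rewrite (le_trans he)// ler_norm.
by near: e; exact: hq.
Unshelve. all: by end_near. Qed.

Lemma continuous_squeeze (f g : R -> R) (u : R) : g u = 0 -> {for u, continuous g} ->
  (\forall t \near u, `|f t - f u| <= g t) -> {for u, continuous f}.
Proof.
move=> gu gc fg; apply/cvgrPdist_lt => eps eps0.
have /cvgr0Pnorm_lt/(_ _ eps0) ge : g @ u --> (0 : R) by rewrite -gu; exact: gc.
near=> t; rewrite distrC.
apply: (@le_lt_trans _ _ (g t)); first by near: t.
by apply: (le_lt_trans (ler_norm _)); near: t.
Unshelve. all: by end_near. Qed.

Lemma sinhc_bounds (r : R) : 0 <= r -> r <= 2^-1 -> 0 <= sinhc r - 1 <= r.
Proof.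
move=> r0 r1; rewrite /sinhc; case: eqVneq => [->|rn0]; first by rewrite subrr lexx.
have rp : 0 < r by rewrite lt_neqAle eq_sym rn0.
rewrite subr_ge0 lerBlDr ler_pdivlMr// ler_pdivrMr// mul1r sinh_gex//=.
by have := sinh_le_quadratic r0 r1; lra.
Qed.

Lemma sinhcN (r : R) : sinhc (- r) = sinhc r.
Proof.
rewrite /sinhc oppr_eq0; case: eqVneq => // r0.
by rewrite sinhN invrN mulrNN.
Qed.

Lemma sinhc_der (r : R) : r != 0 ->
  is_derive r 1 (@sinhc R) ((cosh r * r - sinh r) / r ^+ 2).
Proof.
move=> r0.
have H : is_derive r 1 (fun v : R => sinh v * v^-1)
    (cosh r * r^-1 + sinh r * (- r ^- 2 * 1)).
  apply: der_mul; exact: der_inv.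
have -> : (cosh r * r - sinh r) / r ^+ 2 = cosh r * r^-1 + sinh r * (- r ^- 2 * 1) by field.
apply: near_eq_is_derive H; near=> t; rewrite /sinhc ifF//.
apply/negbTE; near: t.
by apply: open_neq => //; exact: cvg_id.
Unshelve. all: by end_near. Qed.

Lemma sinhc_continuous : continuous (@sinhc R).
Proof.
move=> r; have [->|r0] := eqVneq r 0; last exact: der_continuous (sinhc_der r0).
have s0 : sinhc (0 : R) = 1 by rewrite /sinhc eqxx.
apply: (@continuous_squeeze _ (fun t : R => `|t|) 0); first exact: normr0.
  exact: norm_continuous.
near=> t; rewrite s0.
have -> : sinhc t = sinhc `|t|.
  by case: (ger0P t) => // _; rewrite sinhcN.
have t1 : `|t| <= 2^-1.
  near: t; exists 2^-1; first by rewrite /= invr_gt0.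
  by move=> s; rewrite /ball_ /= sub0r normrN => /ltW.
by have /andP[h1 h2] := sinhc_bounds (normr_ge0 t) t1; rewrite ger0_norm.
Unshelve. all: by end_near. Qed.

Section Vectors.
Variable m : nat.
Implicit Types x y : R -> 'rV[R]_m.

Definition is_derive_row x (u : R) (v : 'rV[R]_m) :=
  forall i, is_derive u 1 (fun t => x t 0 i) (v 0 i).

Lemma der_dot x y u v w : is_derive_row x u v -> is_derive_row y u w ->
  is_derive u 1 (fun t => dot (x t) (y t)) (dot v (y u) + dot (x u) w).
Proof.
move=> xv yw; rewrite /dot -big_split /=.
by apply: der_sum => i; apply: der_mul.
Qed.

Lemma C1_derc x u : C1 x -> is_derive_row x u (velocity x u).
Proof.
by move=> xC i; rewrite mxE derive1E; apply: derivableP; exact: (xC i).1.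
Qed.

Lemma continuous_dot x y u : (forall i, {for u, continuous (fun t => x t 0 i)}) ->
  (forall i, {for u, continuous (fun t => y t 0 i)}) ->
  {for u, continuous (fun t => dot (x t) (y t))}.
Proof.
move=> xc yc; apply: cvg_big => [|i _]; first exact: add_continuous.
by apply: cvgM; [exact: xc|exact: yc].
Qed.

Lemma continuous_enorm x u : (forall i, {for u, continuous (fun t => x t 0 i)}) ->
  {for u, continuous (fun t => enorm (x t))}.
Proof.
move=> xc; apply: (@continuous_comp _ _ _ (fun t => dot (x t) (x t)) Num.sqrt).
  exact: continuous_dot.
exact: sqrt_continuous.
Qed.

Lemma derc_continuous x u v : is_derive_row x u v -> forall i, {for u, continuous (fun t => x t 0 i)}.
Proof. by move=> xv i; exact: der_continuous (xv i). Qed.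

Lemma der_enorm x u v : x u != 0 -> is_derive_row x u v ->
  is_derive u 1 (fun t => enorm (x t)) (dt (x u) v).
Proof.
move=> x0 xv.
have := der_sqrt (dot_gt0 x0) (der_dot xv xv).
move=> h; apply: is_derive_eq h _.
rewrite /dt /enorm (dotC v); have := enorm_gt0 x0; rewrite /enorm => e0.
by field; rewrite gt_eqF.
Qed.

End Vectors.

Section PullBack.
Variable n : nat.
Implicit Types (x : R -> 'rV[R]_n) (th : R -> R).

(** The radial components of [hpt] are differentiable along curves also at [x = 0], where
   [cosh |x| - 1] and [(sinhc |x| - 1) x] are quadratically small. *)
Lemma der_radial x u v : is_derive_row x u v ->
  exists c' y', [/\ is_derive u 1 (fun t => cosh (enorm (x t))) c',
    is_derive_row (fun t => sinhc (enorm (x t)) *: x t) u y' &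
    forall z : 'rV[R]_2,
      gplus (x u) v z = - c' ^+ 2 + dot y' y' + cosh (enorm (x u)) ^+ 2 * dot z z].
Proof.
move=> xv; have xc := continuous_enorm (derc_continuous xv).
have [x0|x0] := eqVneq (x u) 0.
  have e0 : enorm (x u) = 0 by rewrite x0 enorm0.
  have near0 : \forall t \near u, enorm (x t) <= 2^-1.
    have /cvgr0Pnorm_lt/(_ 2^-1) : (fun t => enorm (x t)) @ u --> (0 : R).
      by rewrite -e0; exact: xc.
    rewrite invr_gt0 => /(_ (ltr0Sn _ 1)); apply: filterS => t.
    by rewrite ger0_norm ?enorm_ge0// => /ltW.
  have dd : is_derive u 1 (fun t => dot (x t) (x t)) 0.
    by have := der_dot xv xv; rewrite x0 dot0l dot0r addr0.
  have dd2 : is_derive u 1 (fun t => 2 * dot (x t) (x t)) 0.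
    by apply: is_derive_eq (der_mul (der_cst 2 u) dd) _; rewrite mul0r mulr0 addr0.
  exists 0, v; split.
  - have H : is_derive u 1 (fun t => cosh (enorm (x t)) - 1) 0.
      apply: (der_flat _ dd2); first by rewrite x0 dot0l mulr0.
      apply: filterS near0 => t ht; rewrite -enorm_sqr ger0_norm.
        by apply: coshB1_le; rewrite ger0_norm ?enorm_ge0.
      by rewrite subr_ge0 cosh_ge1.
    have := der_add H (der_cst 1 u); rewrite addr0.
    by under eq_fun do rewrite subrK.
  - move=> i.
    have H : is_derive u 1 (fun t => (sinhc (enorm (x t)) - 1) * x t 0 i) 0.
      apply: (der_flat _ dd); first by rewrite x0 dot0l.
      apply: filterS near0 => t ht; rewrite normrM -enorm_sqr expr2.
      have /andP[s1 s2] := sinhc_bounds (enorm_ge0 _) ht.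
      rewrite (ger0_norm s1) ler_pM//.
      rewrite -(@ler_pXn2r _ 2)// ?nnegrE ?enorm_ge0// real_normK ?num_real//.
      by rewrite enorm_sqr coord_le_dot.
    have := der_add H (xv i); rewrite add0r.
    under eq_fun do rewrite mulrBl mul1r subrK.
    by congr (is_derive _ _ _ _); apply/funext => t; rewrite mxE.
  - by move=> z; rewrite /gplus x0 eqxx enorm0 cosh0; ring.
have e0 := enorm_gt0 x0.
have en0 : enorm (x u) != 0 by rewrite gt_eqF.
have dr := der_enorm x0 xv.
pose r := enorm (x u); pose r' := dt (x u) v.
pose S' := (cosh r * r - sinh r) / r ^+ 2 * r'.
exists (sinh r * r'), (S' *: x u + sinhc r *: v); split.
- exact: (der_comp (g := fun t => enorm (x t)) (is_derive_cosh _) dr).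
- move=> i.
  have := der_mul (der_comp (g := fun t => enorm (x t)) (sinhc_der en0) dr) (xv i).
  rewrite !mxE; congr (is_derive _ _ _ _).
  by apply/funext => t; rewrite mxE.
move=> z; rewrite /gplus (negbTE x0) -/r -/r' /dw -/r -/r' !dotE.
have xvE : dot (x u) v = r * r' by rewrite /r' /dt -/r; field.
rewrite (dotC v (x u)) xvE -(enorm_sqr (x u)) -/r.
have Sr : sinhc r = sinh r / r by rewrite /sinhc ifF//; apply/negbTE.
rewrite Sr /S'; have := cosh2E r.
move: en0; rewrite -/r; move: (dot v v) (dot z z) (cosh r) (sinh r) => a b c s rn0 cs.
apply: subr0_eq; transitivity ((1 + s ^+ 2 - c ^+ 2) * r' ^+ 2).
  by field.
by rewrite cs; ring.
Qed.

(** In Fermi coordinates, [gplus] is the metric induced by the Minkowski form: the hyperbolic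
   angle [th] rotates the first two components, which adds [cosh |x| ^ 2 w ^ 2] to the radial
   part and no mixed terms. *)
Lemma der_hpt x th u v w : is_derive_row x u v -> is_derive u 1 th w ->
  exists A : mink R n, [/\
    is_derive u 1 (fun t => (hpt (x t) (th t)).1.1) A.1.1,
    is_derive u 1 (fun t => (hpt (x t) (th t)).1.2) A.1.2,
    is_derive_row (fun t => (hpt (x t) (th t)).2) u A.2 &
    forall z : 'rV[R]_2, dot z z = w ^+ 2 -> gplus (x u) v z = eta A A].
Proof.
move=> xv thw; have [c' [y' [dc dy g]]] := der_radial xv.
have dch := der_comp (is_derive_cosh _) thw.
have dsh := der_comp (is_derive_sinh _) thw.
exists (c' * cosh (th u) + cosh (enorm (x u)) * (sinh (th u) * w),
        c' * sinh (th u) + cosh (enorm (x u)) * (cosh (th u) * w), y').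
split => //=; [exact: der_mul|exact: der_mul|].
move=> z zw; rewrite g zw /eta /=; have := cosh2E (th u).
set c := cosh (enorm _); set ch := cosh (th u); set sh := sinh (th u) => e.
have -> : - ((c' * ch + c * (sh * w)) * (c' * ch + c * (sh * w))) +
  (c' * sh + c * (ch * w)) * (c' * sh + c * (ch * w)) =
  (ch ^+ 2 - sh ^+ 2) * (c ^+ 2 * w ^+ 2 - c' ^+ 2) by ring.
by rewrite e; ring.
Qed.

(** This form has no division by [enorm x] except in the middle term, whose factor
   [1 - sinhc (enorm x) ^+ 2] vanishes at the origin; so [gplus] is continuous along curves. *)
Lemma gplusE (x v : 'rV[R]_n) (z : 'rV[R]_2) :
  gplus x v z = sinhc (enorm x) ^+ 2 * dot v v +
    (1 - sinhc (enorm x) ^+ 2) * dt x v ^+ 2 + cosh (enorm x) ^+ 2 * dot z z.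
Proof.
rewrite /gplus; have [->|x0] := eqVneq x 0.
  by rewrite /dt enorm0 dot0l cosh0 /sinhc eqxx; ring.
have e0 : enorm x != 0 by rewrite enorm_eq0.
have xvE : dot x v = enorm x * dt x v by rewrite /dt; field.
have -> : dot (dw x v) (dw x v) = enorm x ^- 2 * (dot v v - dt x v ^+ 2).
  rewrite /dw !dotE (dotC v x) xvE -(enorm_sqr x).
  move: (dt x v) (enorm x) e0 (dot v v) => a r r0 b.
  by field.
by rewrite -(sinhcM (enorm x)); field.
Qed.

Lemma gplus_continuous x (y : R -> 'rV[R]_2) : C1 x -> C1 y ->
  continuous (fun u => gplus (x u) (velocity x u) (velocity y u)).
Proof.
move=> xC yC u.
have xc t i : {for t, continuous (fun t => x t 0 i)}.
  exact: derc_continuous (C1_derc t xC) i.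
have vc t i : {for t, continuous (fun t => velocity x t 0 i)}.
  have -> : (fun t => velocity x t 0 i) = derive1 (fun t => x t 0 i).
    by apply/funext => s; rewrite mxE.
  exact: (xC i).2.
have wc t i : {for t, continuous (fun t => velocity y t 0 i)}.
  have -> : (fun t => velocity y t 0 i) = derive1 (fun t => y t 0 i).
    by apply/funext => s; rewrite mxE.
  exact: (yC i).2.
have ec := continuous_enorm (xc u).
have sc : {for u, continuous (fun t => sinhc (enorm (x t)) ^+ 2)}.
  apply: (@continuous_comp _ _ _ (fun t => sinhc (enorm (x t))) (fun r => r ^+ 2)).
    by apply: (@continuous_comp _ _ _ _ (@sinhc R)) => //; exact: sinhc_continuous.
  exact: exprn_continuous.
have cc : {for u, continuous (fun t => cosh (enorm (x t)) ^+ 2)}.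
  apply: (@continuous_comp _ _ _ (fun t => cosh (enorm (x t))) (fun r => r ^+ 2)).
    apply: (@continuous_comp _ _ _ _ (@cosh R)) => //.
    exact: der_continuous (is_derive_cosh _).
  exact: exprn_continuous.
have vv := continuous_dot (vc u) (vc u).
have ww := continuous_dot (wc u) (wc u).
rewrite (funext (fun t => gplusE (x t) (velocity x t) (velocity y t))).
have mid : {for u, continuous (fun t => (1 - sinhc (enorm (x t)) ^+ 2) * dt (x t) (velocity x t) ^+ 2)}.
  have s1 : {for u, continuous (fun t => 1 - sinhc (enorm (x t)) ^+ 2)}.
    by apply: cvgB; [exact: cvg_cst|exact: sc].
  have [x0|x0] := eqVneq (x u) 0.
    apply: (@continuous_squeeze _ (fun t => `|1 - sinhc (enorm (x t)) ^+ 2| * dot (velocity x t) (velocity x t))).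
    - by rewrite x0 enorm0 /sinhc eqxx expr1n subrr normr0 mul0r.
    - by apply: cvgM; [exact: cvg_norm s1|exact: vv].
    - near=> t; rewrite x0 /dt dot0l mul0r expr0n mulr0 subr0 normrM ler_wpM2l//.
      rewrite ger0_norm ?sqr_ge0//; have [->|xt] := eqVneq (x t) 0.
        by rewrite dot0l mul0r expr0n dot_ge0.
      rewrite exprMn exprVn ler_pdivrMr ?exprn_gt0 ?enorm_gt0//.
      by rewrite enorm_sqr mulrC dot_cauchy_schwarz.
  have d1 : {for u, continuous (fun t => dt (x t) (velocity x t))}.
    apply: cvgM; first exact: (continuous_dot (xc u) (vc u)).
    by apply: cvgV; rewrite ?enorm_eq0.
  apply: cvgM => //.
  apply: (@continuous_comp _ _ _ (fun t => dt (x t) (velocity x t)) (fun r => r ^+ 2)) => //.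
  exact: exprn_continuous.
exact: (cvgD (cvgD (cvgM sc vv) mid) (cvgM cc ww)).
Unshelve. all: by end_near. Qed.

End PullBack.

End Curves.

(** * Lower bounds for lengths of curves *)

Section OneVariable.
Context {R : realType}.
Implicit Types f : R -> R.

Lemma ndecr_unit_interval f :
  (forall u : R, -1 < u -> exists2 d : R, is_derive u 1 f d & (0 < u < 1 -> 0 <= d)) ->
  forall a b, 0 <= a -> a <= b -> b <= 1 -> f a <= f b.
Proof.
move=> fd a b a0 ab b1.
have N1 (u : R) : u \in `]0, 1[ -> -1 < u by rewrite in_itv/= => /andP[? _]; lra.
apply: (@ger0_derive1_ndecr _ f 0 1) => //.
- by move=> u /N1/fd[d [? _] _].
- move=> u u01; have [d fdu] := fd u (N1 u u01).
  rewrite derive1E; have [_ ->] := fdu; apply; by rewrite in_itv/= in u01.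
- apply: continuous_in_subspaceT => u; rewrite inE/= in_itv/= => /andP[u0 _].
  by have [|d fdu _] := fd u; [lra|exact: der_continuous fdu].
Qed.

Lemma const_unit_interval f (df : R -> R) : (forall u : R, -1 < u -> is_derive u 1 f (df u)) ->
  (forall u : R, 0 < u < 1 -> df u = 0) -> forall u : R, 0 <= u <= 1 -> f u = f 0.
Proof.
move=> fd df0 u /andP[u0 u1]; apply/eqP; rewrite eq_le; apply/andP; split.
  rewrite -lerN2; apply: (@ndecr_unit_interval (fun v => - f v)) => // v v1.
  exists (- df v); first exact: der_opp (fd v v1).
  by move=> /df0 ->; rewrite oppr0.
apply: (@ndecr_unit_interval f) => // v v1; exists (df v); first exact: fd.
by move=> /df0 ->.
Qed.

(** The antiderivative is needed a little to the left of [0], in order to be differentiable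
   in the usual sense at [0]. *)
Lemma antiderivative f : continuous f -> exists2 F : R -> R,
  (forall u : R, -1 < u -> is_derive u 1 F (f u)) &
  \int[@lebesgue_measure R]_(u in `[0, 1]) f u = F 1 - F 0.
Proof.
move=> fc.
pose F (u : R) := \int[@lebesgue_measure R]_(t in `[-1, u]) f t.
have Fd (u : R) : -1 < u -> is_derive u 1 F (f u).
  move=> u1.
  have fi : (@lebesgue_measure R).-integrable `[-1, (u + 1)%R] (EFin \o f).
    apply: continuous_compact_integrable; first exact: segment_compact.
    exact: continuous_subspaceT.
  have uu : u < u + 1 by rewrite ltrDl.
  have [Fd FE] := continuous_FTC1_closed uu fi u1 (fc u).
  by apply: DeriveDef; [exact: Fd|rewrite -derive1E; exact: FE].
exists F => //; rewrite /Rintegral.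
have Fc (u : R) : 0 <= u -> {for u, continuous F}.
  by move=> u0; apply: der_continuous (Fd u _); lra.
rewrite (@continuous_FTC2 _ f F 0 1)//.
- exact: continuous_subspaceT.
- split.
  + move=> u; rewrite in_itv/= => /andP[u0 _].
    by have [|] := Fd u; first lra.
  + by apply: cvg_at_right_filter; apply: Fc.
  + by apply: cvg_at_left_filter; apply: Fc.
- move=> u; rewrite in_itv/= => /andP[u0 _]; rewrite derive1E.
  by have [|_ ->] := Fd u; first lra.
Qed.

End OneVariable.

Section CircleLift.
Context {R : realType}.
Variable lambda : R.
Hypothesis lambda_gt0 : 0 < lambda.

(** The point of the circle at signed arc length [th] from [(lambda, 0)]. *)
Definition cpt (th : R) : 'rV[R]_2 :=
  \row_i (if i == 0 then lambda * cos (th / lambda) else lambda * sin (th / lambda)).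

Lemma dot2E (u v : 'rV[R]_2) : dot u v = u 0 0 * v 0 0 + u 0 1 * v 0 1.
Proof.
rewrite /dot big_ord_recl big_ord1; congr (_ + u 0 _ * v 0 _); exact: val_inj.
Qed.

Lemma cpt0E th : cpt th 0 0 = lambda * cos (th / lambda).
Proof. by rewrite mxE. Qed.

Lemma cpt1E th : cpt th 0 1 = lambda * sin (th / lambda).
Proof. by rewrite mxE. Qed.

Lemma row2P (u v : 'rV[R]_2) : u 0 0 = v 0 0 -> u 0 1 = v 0 1 -> u = v.
Proof.
move=> h0 h1; apply/rowP => -[[|[|//]] i2].
  by have -> : Ordinal i2 = 0 by apply: val_inj.
by have -> : Ordinal i2 = 1 by apply: val_inj.
Qed.

Lemma enorm_cpt th : enorm (cpt th) = lambda.
Proof.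
rewrite /enorm dot2E cpt0E cpt1E.
have -> : lambda * cos (th / lambda) * (lambda * cos (th / lambda)) +
    lambda * sin (th / lambda) * (lambda * sin (th / lambda)) =
    lambda ^+ 2 * (cos (th / lambda) ^+ 2 + sin (th / lambda) ^+ 2) by ring.
by rewrite cos2Dsin2 mulr1 sqrtr_sqr gtr0_norm.
Qed.

Lemma cpt_surj (y : 'rV[R]_2) : enorm y = lambda ->
  exists2 th, `|th| <= pi * lambda & y = cpt th.
Proof.
move=> yl; have l0 : lambda != 0 by rewrite gt_eqF.
have e : (y 0 0 / lambda) ^+ 2 + (y 0 1 / lambda) ^+ 2 = 1.
  have := enorm_sqr y; rewrite yl dot2E => h.
  by transitivity ((y 0 0 * y 0 0 + y 0 1 * y 0 1) / lambda ^+ 2); [field|rewrite -h divff// expf_neq0].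
set a := y 0 0 / lambda in e; set b := y 0 1 / lambda in e.
have a1 : -1 <= a <= 1.
  by rewrite -ler_norml -(@expr_le1 _ 2)// real_normK ?num_real//; have := sqr_ge0 b; lra.
have sE : sin (acos a) = `|b|.
  by rewrite sin_acos// -sqrtr_sqr; congr Num.sqrt; lra.
exists (lambda * (if 0 <= b then acos a else - acos a)).
  rewrite normrM (gtr0_norm lambda_gt0) mulrC ler_pM2r//.
  have -> : `|if 0 <= b then acos a else - acos a| = acos a.
    by case: ifP => _; rewrite ?normrN ger0_norm// acos_ge0.
  exact: acos_lepi.
apply: row2P; rewrite ?cpt0E ?cpt1E (mulrC lambda (if _ then _ else _)) mulfK//.
  have -> : cos (if 0 <= b then acos a else - acos a) = a.
    by case: ifP => _; rewrite ?cosN acosK.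
  by rewrite /a mulrC divfK.
have -> : sin (if 0 <= b then acos a else - acos a) = b.
  case: (lerP 0 b) => b0; first by rewrite sE ger0_norm.
  by rewrite sinN sE ltr0_norm// opprK.
by rewrite /b mulrC divfK.
Qed.

(** The cross product of [y] and [y'] divided by [lambda] is [lambda] times the angular
   speed, so its antiderivative [th] is the only candidate for a lift. It is one because the
   component of [y] along the unit vector of angle [th / lambda] has derivative zero, hence
   keeps its initial value [lambda], the largest possible one. *)
Lemma circle_lift (y : R -> 'rV[R]_2) th0 : C1 y ->
  (forall u, u \in `[0, 1] -> enorm (y u) = lambda) -> y 0 = cpt th0 ->
  exists th w : R -> R, [/\ th 0 = th0,
    (forall u : R, -1 < u -> is_derive u 1 th (w u)),
    (forall u : R, 0 <= u <= 1 -> y u = cpt (th u)) &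
    (forall u : R, 0 < u < 1 -> dot (velocity y u) (velocity y u) = w u ^+ 2)].
Proof.
move=> yC yl y0; have l0 : lambda != 0 by rewrite gt_eqF.
pose v := velocity y.
have yv (u : R) : is_derive_row y u (v u) by exact: C1_derc.
have vc i : continuous (fun u => v u 0 i).
  move=> u; have -> : (fun t => v t 0 i) = derive1 (fun t => y t 0 i).
    by apply/funext => t; rewrite mxE.
  exact: (yC i).2.
have yc i : continuous (fun u => y u 0 i).
  by move=> u; exact: derc_continuous (yv u) i.
pose w u := (y u 0 0 * v u 0 1 - y u 0 1 * v u 0 0) / lambda.
have wc : continuous w.
  move=> u.
  exact: (cvgM (cvgB (cvgM (yc 0 u) (vc 1 u)) (cvgM (yc 1 u) (vc 0 u))) (cvg_cst _)).
have [F Fd _] := antiderivative wc.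
pose th u := th0 + (F u - F 0).
have thd (u : R) : -1 < u -> is_derive u 1 th (w u).
  move=> u1; have := der_add (der_cst th0 u) (der_sub (Fd u u1) (der_cst (F 0) u)).
  by rewrite subr0 add0r.
have sq (u : R) : 0 <= u <= 1 -> y u 0 0 ^+ 2 + y u 0 1 ^+ 2 = lambda ^+ 2.
  by move=> u01; rewrite -(yl u) ?in_itv// enorm_sqr dot2E; ring.
have orth (u : R) : 0 < u < 1 -> y u 0 0 * v u 0 0 + y u 0 1 * v u 0 1 = 0.
  move=> /andP[u0 u1].
  have h1 := der_dot (yv u) (yv u).
  have h2 : is_derive u 1 (fun t => dot (y t) (y t)) 0.
    apply: near_eq_is_derive (der_cst (lambda ^+ 2) u).
    near=> t; rewrite -(yl t) ?enorm_sqr// in_itv/=; apply/andP; split; apply: ltW; near: t.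
      exact: lt_nbhsr.
    exact: lt_nbhsl.
  have [_ e1] := h1; have [_ e2] := h2; move: e1; rewrite e2 !dot2E; lra.
exists th, w; split => //.
- by rewrite /th subrr addr0.
- pose g u := y u 0 0 * cos (th u / lambda) + y u 0 1 * sin (th u / lambda).
  pose dg u := (v u 0 0 * cos (th u / lambda) + y u 0 0 * (- sin (th u / lambda) * (w u * lambda^-1 + th u * 0))) +
    (v u 0 1 * sin (th u / lambda) + y u 0 1 * (cos (th u / lambda) * (w u * lambda^-1 + th u * 0))).
  have gd (u : R) : -1 < u -> is_derive u 1 g (dg u).
    move=> u1.
    have tl := der_mul (thd u u1) (der_cst lambda^-1 u).
    apply: der_add; apply: der_mul; try exact: (yv u).
  have dg0 (u : R) : 0 < u < 1 -> dg u = 0.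
    move=> u01; have o := orth u u01; have /andP[u0 u1] := u01.
    have s : y u 0 0 ^+ 2 + y u 0 1 ^+ 2 = lambda ^+ 2 by apply: sq; rewrite !ltW.
    rewrite /dg /w mulr0 addr0.
    move: (cos _) (sin _) o s; move: (y u 0 0) (y u 0 1) (v u 0 0) (v u 0 1) => a b a' b' c s o e.
    have -> : a' * c + a * (- s * ((a * b' - b * a') / lambda / lambda)) +
        (b' * s + b * (c * ((a * b' - b * a') / lambda / lambda))) =
        (c * (a' * lambda ^+ 2 + b * (a * b' - b * a')) +
         s * (b' * lambda ^+ 2 - a * (a * b' - b * a'))) / lambda ^+ 2 by field.
    rewrite -e.
    have -> : c * (a' * (a ^+ 2 + b ^+ 2) + b * (a * b' - b * a')) +
        s * (b' * (a ^+ 2 + b ^+ 2) - a * (a * b' - b * a')) =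
        (a * a' + b * b') * (c * a + s * b) by ring.
    by rewrite o !mul0r.
  move=> u u01; have := const_unit_interval gd dg0 u01.
  have -> : g 0 = lambda.
    rewrite /g /th subrr addr0 y0 cpt0E cpt1E.
    transitivity (lambda * (cos (th0 / lambda) ^+ 2 + sin (th0 / lambda) ^+ 2)); first ring.
    by rewrite cos2Dsin2 mulr1.
  rewrite /g => gl; have s := sq u u01; have cs := cos2Dsin2 (th u / lambda).
  suff : (y u 0 0 - lambda * cos (th u / lambda)) ^+ 2 +
      (y u 0 1 - lambda * sin (th u / lambda)) ^+ 2 = 0.
    move=> /eqP; rewrite paddr_eq0 ?sqr_ge0// !sqrf_eq0 !subr_eq0 => /andP[/eqP e0 /eqP e1].
    by apply: row2P; rewrite ?cpt0E ?cpt1E.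
  move: gl s cs; set c := cos _; set q := sin _; move: (y u 0 0) (y u 0 1) => a b gl s cs.
  have -> : (a - lambda * c) ^+ 2 + (b - lambda * q) ^+ 2 =
    (a ^+ 2 + b ^+ 2) + lambda ^+ 2 * (c ^+ 2 + q ^+ 2) - 2 * lambda * (a * c + b * q) by ring.
  by rewrite s cs gl; ring.
- move=> u u01; have o := orth u u01; have /andP[u0 u1] := u01.
  have : y u 0 0 ^+ 2 + y u 0 1 ^+ 2 = lambda ^+ 2 by apply: sq; rewrite !ltW.
  rewrite dot2E /w -/v; move: o.
  move: (y u 0 0) (y u 0 1) (v u 0 0) (v u 0 1) => a b a' b' o s.
  have -> : ((a * b' - b * a') / lambda) ^+ 2 =
     ((a ^+ 2 + b ^+ 2) * (a' ^+ 2 + b' ^+ 2) - (a * a' + b * b') ^+ 2) / lambda ^+ 2 by field.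
  by rewrite o s; field.
Unshelve. all: by end_near. Qed.

End CircleLift.

Section LowerBound.
Context {R : realType}.
Variables (n : nat) (lambda : R).
Hypothesis lambda_gt0 : 0 < lambda.

Definition is_derive_mink (P : R -> mink R n) (u : R) (A : mink R n) :=
  [/\ is_derive u 1 (fun t => (P t).1.1) A.1.1,
      is_derive u 1 (fun t => (P t).1.2) A.1.2 &
      is_derive_row (fun t => (P t).2) u A.2].

Lemma der_eta P Q u A B : is_derive_mink P u A -> is_derive_mink Q u B ->
  is_derive u 1 (fun t => eta (P t) (Q t)) (eta A (Q u) + eta (P u) B).
Proof.
move=> [p1 p2 p3] [q1 q2 q3].
have := der_add (der_add (der_opp (der_mul p1 q1)) (der_mul p2 q2)) (der_dot p3 q3).
by congr (is_derive _ _ _ _); rewrite /eta; ring.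
Qed.

Lemma derm_cst N u : is_derive_mink (fun=> N) u (0, 0, 0).
Proof. by split; [exact: der_cst|exact: der_cst|move=> i /=; rewrite mxE; exact: der_cst]. Qed.

Lemma derm_tangent Q u A : (forall t, hyperboloid (Q t)) -> is_derive_mink Q u A -> eta A (Q u) = 0.
Proof.
move=> hQ QA; have := der_eta QA QA.
have -> : (fun t => eta (Q t) (Q t)) = fun=> -1 by apply/funext => t; have [] := hQ t.
move=> [_ e1]; have [_ e2] := der_cst (-1) u.
by move: e1; rewrite e2 (etaC (Q u) A); lra.
Qed.

(** By [calibration_bound] the derivative of [asinh (eta N .)] along the lift is at most the
   speed of the curve, so lengths dominate the variation of such calibrations. *)
Lemma arc_calibration x y (p q : X n lambda) x0 th0 :
  C1_arc x y p q -> sval p = (x0, cpt lambda th0) ->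
  exists x1 th1, sval q = (x1, cpt lambda th1) /\
    forall N, eta N N = 1 ->
      asinh (eta N (hpt x1 th1)) - asinh (eta N (hpt x0 th0)) <= arc_length x y.
Proof.
move=> [xC yC yl e0 e1] pE; move: e0; rewrite pE => -[xE yE].
have [th [w [th0E thd ycpt vw]]] := circle_lift lambda_gt0 yC yl yE.
exists (x 1), (th 1); split.
  by rewrite -e1; congr pair; apply: ycpt; rewrite ler01 lexx.
move=> N NN; rewrite -xE -th0E.
pose gg u := Num.sqrt (gplus (x u) (velocity x u) (velocity y u)).
have gc : continuous gg.
  move=> u; apply: (@continuous_comp _ _ _ (fun u => gplus (x u) (velocity x u) (velocity y u)) Num.sqrt).
    exact: gplus_continuous.
  exact: sqrt_continuous.
have [G Gd GE] := antiderivative gc.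
rewrite /arc_length GE.
pose b u := asinh (eta N (hpt (x u) (th u))).
suff : G 0 - b 0 <= G 1 - b 1 by rewrite /b; lra.
apply: (@ndecr_unit_interval _ (fun u => G u - b u)) => // u u1.
have [A [A1 A2 A3 gA]] := der_hpt (C1_derc u xC) (thd u u1).
have QA : is_derive_mink (fun t => hpt (x t) (th t)) u A by split.
have hQ t : hyperboloid (hpt (x t) (th t)) by exact: hpt_hyperboloid.
have AQ := derm_tangent hQ QA.
have dN := der_eta (derm_cst N u) QA.
have d0 : eta (0, 0, 0) (hpt (x u) (th u)) = 0 by rewrite /eta /= dot0l; ring.
rewrite d0 add0r in dN.
have db := der_comp (g := fun t => eta N (hpt (x t) (th t))) (is_derive_asinh _) dN.
exists (gg u - (Num.sqrt (1 + eta N (hpt (x u) (th u)) ^+ 2))^-1 * eta N A).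
  exact: der_sub (Gd u u1) db.
move=> /vw zz; rewrite subr_ge0 /gg (gA _ zz).
have N0 : 0 < 1 + eta N (hpt (x u) (th u)) ^+ 2 by have := sqr_ge0 (eta N (hpt (x u) (th u))); lra.
rewrite mulrC ler_pdivrMr ?sqrtr_gt0// mulrC -sqrtrM; last exact: ltW N0.
apply: (le_trans (ler_norm _)); rewrite -sqrtr_sqr ler_sqrt.
  exact: calibration_bound.
by rewrite mulr_ge0 ?(ltW N0)//; exact: tangent_ge0 AQ.
Qed.

Lemma joined_calibration (p q : X n lambda) l x0 th0 :
  joined p q l -> sval p = (x0, cpt lambda th0) ->
  exists x1 th1, sval q = (x1, cpt lambda th1) /\
    forall N, eta N N = 1 ->
      asinh (eta N (hpt x1 th1)) - asinh (eta N (hpt x0 th0)) <= l.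
Proof.
move=> j; elim: j x0 th0 => {p q l} [p|p q r x y l arc _ IH] x0 th0 pE.
  by exists x0, th0; split => // N _; rewrite subrr.
have [x1 [th1 [qE h1]]] := arc_calibration arc pE.
have [x2 [th2 [rE h2]]] := IH _ _ qE.
exists x2, th2; split => // N NN.
by have := h1 N NN; have := h2 N NN; lra.
Qed.

Lemma joined_ge0 (p q : X n lambda) l : joined p q l -> 0 <= l.
Proof.
elim=> {p q l} [p|p q r x y l _ _ l0]; first by [].
by rewrite addr_ge0//; apply: Rintegral_ge0 => u _; exact: sqrtr_ge0.
Qed.

(** A curve of length [l] lifts to hyperbolic space with end points at hyperbolic
   distance at most [l]: take for [N] the direction of the geodesic between them. *)
Lemma joined_lift (p q : X n lambda) l x0 th0 :
  joined p q l -> sval p = (x0, cpt lambda th0) ->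
  exists x1 th1, sval q = (x1, cpt lambda th1) /\
    - eta (hpt x0 th0) (hpt x1 th1) <= cosh l.
Proof.
move=> j pE; have [x1 [th1 [qE h]]] := joined_calibration j pE.
exists x1, th1; split => //.
have hP := hpt_hyperboloid x0 th0; have hQ := hpt_hyperboloid x1 th1.
have := eta_hpt_ge1 x0 th0 x1 th1.
set P := hpt x0 th0 in h hP *; set Q := hpt x1 th1 in h hQ *; set c := - eta P Q => c1.
have [->|cn1] := eqVneq c 1; first exact: cosh_ge1.
have c2 : 0 < c ^+ 2 - 1.
  have : 1 < c by rewrite lt_neqAle eq_sym cn1.
  by move=> ?; nra.
set s := Num.sqrt (c ^+ 2 - 1).
have s0 : 0 < s by rewrite sqrtr_gt0.
have s2 : s ^+ 2 = c ^+ 2 - 1 by rewrite sqr_sqrtr// ltW.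
have [PP _] := hP; have [QQ _] := hQ.
have PQ : eta P Q = - c by rewrite /c opprK.
have := h (lincomb s^-1 Q (- (c / s)) P).
have -> : eta (lincomb s^-1 Q (- (c / s)) P) (lincomb s^-1 Q (- (c / s)) P) = 1.
  rewrite !eta_lcl !eta_lcr PP QQ (etaC Q P) PQ.
  transitivity ((c ^+ 2 - 1) / s ^+ 2); first by field; rewrite gt_eqF.
  by rewrite s2 divff// gt_eqF.
have -> : eta (lincomb s^-1 Q (- (c / s)) P) P = 0.
  by rewrite eta_lcl PP (etaC Q P) PQ; field; rewrite gt_eqF.
have -> : eta (lincomb s^-1 Q (- (c / s)) P) Q = s.
  rewrite eta_lcl QQ PQ.
  transitivity ((c ^+ 2 - 1) / s); first by field; rewrite gt_eqF.
  by rewrite -s2 expr2 mulfK// gt_eqF.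
move=> /(_ erefl); rewrite asinh0 subr0 -ler_sinh asinhK => sl.
rewrite -(@ler_pXn2r _ 2)// ?nnegrE ?(ltW (cosh_gt0 _))//; last by lra.
rewrite cosh2E addrC -lerBlDr -s2 ler_pXn2r// ?nnegrE ?(ltW s0)//.
exact: le_trans (ltW s0) sl.
Qed.

End LowerBound.

(** * Geodesics *)

Section C1Functions.
Context {R : realType}.
Implicit Types f g : R -> R.

Definition C1f f := exists2 df : R -> R,
  (forall u : R, is_derive u 1 f (df u)) & continuous df.

Lemma C1f_continuous f : C1f f -> continuous f.
Proof. by move=> [df fd _] u; exact: der_continuous (fd u). Qed.

Lemma C1f_cst (c : R) : C1f (fun=> c).
Proof. by exists (fun=> 0) => [u|u]; [exact: der_cst|exact: cvg_cst]. Qed.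

Lemma C1f_id : C1f (fun u => u).
Proof. by exists (fun=> 1) => [u|u]; [exact: der_id|exact: cvg_cst]. Qed.

Lemma C1f_add f g : C1f f -> C1f g -> C1f (fun u => f u + g u).
Proof.
move=> [df fd fc] [dg gd gc]; exists (fun u => df u + dg u) => u; first exact: der_add.
by apply: cvgD; [exact: fc|exact: gc].
Qed.

Lemma C1f_mul f g : C1f f -> C1f g -> C1f (fun u => f u * g u).
Proof.
move=> fC gC; have f0 := C1f_continuous fC; have g0 := C1f_continuous gC.
case: fC => df fd fc; case: gC => dg gd gc.
exists (fun u => df u * g u + f u * dg u) => u; first exact: der_mul.
exact: (cvgD (cvgM (fc u) (g0 u)) (cvgM (f0 u) (gc u))).
Qed.

Lemma C1f_comp f g : C1f f -> C1f g -> C1f (fun u => f (g u)).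
Proof.
move=> [df fd fc] gC; have g0 := C1f_continuous gC; case: gC => dg gd gc.
exists (fun u => df (g u) * dg u) => u; first exact: der_comp.
apply: cvgM; last exact: gc.
by apply: (@continuous_comp _ _ _ g df); [exact: g0|exact: fc].
Qed.

Lemma C1f_inv f : (forall u, f u != 0) -> C1f f -> C1f (fun u => (f u)^-1).
Proof.
move=> fn0 fC; have f0 := C1f_continuous fC; case: fC => df fd fc.
exists (fun u => - (f u) ^- 2 * df u) => u; first exact: der_inv.
apply: cvgM; last exact: fc.
apply: cvgN; apply: cvgV; first by rewrite expf_neq0.
by apply: (@continuous_comp _ _ _ f (fun r => r ^+ 2)); [exact: f0|exact: exprn_continuous].
Qed.

Lemma C1f_sqrt f : (forall u, 0 < f u) -> C1f f -> C1f (fun u => Num.sqrt (f u)).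
Proof.
move=> fp fC; have f0 := C1f_continuous fC; case: fC => df fd fc.
exists (fun u => (2 * Num.sqrt (f u))^-1 * df u) => u; first exact: der_sqrt.
apply: cvgM; last exact: fc.
apply: cvgV; first by rewrite mulf_neq0// gt_eqF// sqrtr_gt0.
apply: cvgM; first exact: cvg_cst.
by apply: (@continuous_comp _ _ _ f Num.sqrt); [exact: f0|exact: sqrt_continuous].
Qed.

Lemma C1f_sinh : C1f (@sinh R).
Proof.
exists (@cosh R) => u; first exact: is_derive_sinh.
exact: der_continuous (is_derive_cosh u).
Qed.

Lemma C1f_cosh : C1f (@cosh R).
Proof.
exists (@sinh R) => u; first exact: is_derive_cosh.
exact: der_continuous (is_derive_sinh u).
Qed.

Lemma C1f_cos : C1f (@cos R).
Proof.
exists (fun u => - sin u) => u; first exact: is_derive_cos.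
by apply: cvgN; exact: der_continuous (is_derive_sin u).
Qed.

Lemma C1f_sin : C1f (@sin R).
Proof.
exists (@cos R) => u; first exact: is_derive_sin.
exact: der_continuous (is_derive_cos u).
Qed.

Lemma C1f_asinh : C1f (@asinh R).
Proof.
have p u : 0 < 1 + u * u :> R by have := sqr_ge0 u; rewrite expr2; lra.
exists (fun u => (Num.sqrt (1 + u * u))^-1) => [u|].
  by rewrite -expr2; exact: is_derive_asinh.
apply: C1f_continuous; apply: C1f_inv; first by move=> u; rewrite gt_eqF// sqrtr_gt0.
by apply: C1f_sqrt => //; exact: (C1f_add (C1f_cst 1) (C1f_mul C1f_id C1f_id)).
Qed.

Lemma C1f_C1 m (x : R -> 'rV[R]_m) : (forall i, C1f (fun u => x u 0 i)) -> C1 x.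
Proof.
move=> xC i; have [df fd fc] := xC i; split; first by move=> u; have [] := fd u.
have -> : derive1 (fun v => x v 0 i) = df; last exact: fc.
by apply/funext => u; rewrite derive1E; have [_ ->] := fd u.
Qed.

End C1Functions.

Section Geodesics.
Context {R : realType}.
Variable n : nat.
Implicit Types P Q N V W : mink R n.

Lemma eta_hyperboloid_le P Q : hyperboloid P -> hyperboloid Q -> 1 <= - eta P Q.
Proof. by move=> hP hQ; rewrite -(hpt_surj hP) -(hpt_surj hQ) eta_hpt_ge1. Qed.

Lemma hyperboloid_dot V : hyperboloid V ->
  1 + dot V.2 V.2 = V.1.1 * V.1.1 + -1 * (V.1.2 * V.1.2).
Proof. by move=> /hyperboloid_sqr; lra. Qed.

(** The two sheets of [eta V V = -1] are told apart by the sign of [eta V P]. *)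
Lemma hyperboloid_of_eta P V : hyperboloid P -> eta V V = -1 -> eta V P < 0 ->
  hyperboloid V.
Proof.
move=> hP VV VP; split => //; rewrite ltNge; apply/negP => V0.
pose W := lincomb (-1) V 0 V.
have WW : eta W W = -1 by rewrite !eta_lcl !eta_lcr VV; ring.
have W0 : 0 < W.1.1.
  rewrite /W /= mul0r addr0 mulN1r oppr_gt0 lt_neqAle V0 andbT.
  apply/eqP => e; move: VV; rewrite /eta e.
  by have := dot_ge0 V.2; have := sqr_ge0 V.1.2; lra.
have := eta_hyperboloid_le (conj WW W0) hP.
by rewrite eta_lcl; lra.
Qed.

Lemma mink_derE (F : R -> mink R n) u A B : is_derive_mink F u A -> is_derive_mink F u B -> A = B.
Proof.
move=> [[_ a1] [_ a2] a3] [[_ b1] [_ b2] b3].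
have e3 : A.2 = B.2.
  by apply/rowP => i; have [_ <-] := a3 i; have [_ <-] := b3 i.
by move: a1 a2 b1 b2 e3; case: A {a3} => [[a a'] v]; case: B {b3} => [[b b'] w] /= <- <- <- <- ->.
Qed.

Lemma lc_sub_eq0 P Q : lincomb 1 P (-1) Q = (0, 0, 0) -> P = Q.
Proof.
case: P => [[a b] c]; case: Q => [[a' b'] c'] [] /=.
rewrite !mul1r !mulN1r scale1r scaleN1r => /eqP e1 /eqP e2 /eqP e3.
by rewrite !subr_eq0 in e1 e2 e3; rewrite (eqP e1) (eqP e2) (eqP e3).
Qed.

Lemma hpt_inj (x x' : 'rV[R]_n) (th th' : R) :
  hpt x th = hpt x' th' -> x = x' /\ th = th'.
Proof.
move=> e; have [ex et] := hcoordK x th; have [ex' et'] := hcoordK x' th'.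
by split; [rewrite -ex e ex'|rewrite -et e et'].
Qed.

Lemma lc_endpoint (c s : R) P Q : s != 0 ->
  lincomb c P s (lincomb s^-1 Q (- (c / s)) P) = Q.
Proof.
move=> s0; rewrite /lincomb /= scalerDr !scalerA divff//.
have e a b : c * a + s * (s^-1 * b + - (c / s) * a) = b by field.
have -> : s * - (c / s) = - c by field.
by rewrite !e scale1r addrCA -scalerDl subrr scale0r addr0; case: Q => [[]].
Qed.

Definition geodesic P N (d u : R) := lincomb (cosh (d * u)) P (sinh (d * u)) N.

Section Geodesic.
Variables (P N : mink R n) (d : R).
Hypotheses (hP : hyperboloid P) (NP : eta N P = 0) (NN : eta N N = 1).

Lemma geodesic_hyperboloid u : hyperboloid (geodesic P N d u).
Proof.
have [PP _] := hP; apply: (hyperboloid_of_eta hP).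
  rewrite /geodesic !eta_lcl !eta_lcr PP NN NP (etaC P N) NP.
  transitivity (sinh (d * u) ^+ 2 - cosh (d * u) ^+ 2); first by ring.
  by rewrite cosh2E; ring.
by rewrite /geodesic eta_lcl PP NP; have := cosh_gt0 (d * u); lra.
Qed.

Lemma C1f_geodesic (a b : R) : C1f (fun u => cosh (d * u) * a + sinh (d * u) * b).
Proof.
have dC : C1f (fun u => d * u) by apply: C1f_mul; [exact: C1f_cst|exact: C1f_id].
apply: C1f_add; apply: C1f_mul; try exact: C1f_cst.
  exact: (C1f_comp C1f_cosh dC).
exact: (C1f_comp C1f_sinh dC).
Qed.

Lemma derm_geodesic u :
  is_derive_mink (geodesic P N d) u (lincomb (d * sinh (d * u)) P (d * cosh (d * u)) N).
Proof.
have dd : is_derive u 1 (fun u => d * u) d.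
  by apply: is_derive_eq (der_mul (der_cst d u) (der_id u)) _; rewrite mul0r add0r mulr1.
have H (a b : R) : is_derive u 1 (fun u => cosh (d * u) * a + sinh (d * u) * b)
    (d * sinh (d * u) * a + d * cosh (d * u) * b).
  have dch := der_comp (g := fun u => d * u) (is_derive_cosh _) dd.
  have dsh := der_comp (g := fun u => d * u) (is_derive_sinh _) dd.
  apply: is_derive_eq (der_add (der_mul dch (der_cst a u)) (der_mul dsh (der_cst b u))) _.
  by rewrite !mulr0 !addr0 (mulrC (sinh _)) (mulrC (cosh _)).
split; [exact: H|exact: H|move=> i].
by rewrite /= !mxE; under eq_fun do rewrite !mxE; exact: H.
Qed.

Lemma C1f_hcoord_th : C1f (fun u => hcoord_th (geodesic P N d u)).
Proof.
apply: (C1f_comp C1f_asinh); apply: C1f_mul; first exact: C1f_geodesic.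
have p u : 0 < 1 + dot (geodesic P N d u).2 (geodesic P N d u).2.
  by have := dot_ge0 (geodesic P N d u).2; lra.
apply: C1f_inv; first by move=> u; rewrite gt_eqF// sqrtr_gt0.
apply: C1f_sqrt => //.
rewrite (funext (fun u => hyperboloid_dot (geodesic_hyperboloid u))).
have c1 := C1f_geodesic P.1.1 N.1.1; have c2 := C1f_geodesic P.1.2 N.1.2.
apply: (C1f_add (C1f_mul c1 c1)).
by apply: (C1f_mul (C1f_cst (-1))); exact: (C1f_mul c2 c2).
Qed.

(** Reading the geodesic in polar coordinates: either it avoids the axis, where they are
   smooth, or it meets the axis and moves along a fixed line of [R^n]. *)
Lemma geodesic_coord : exists2 x : R -> 'rV[R]_n, C1 x &
  forall u, hpt (x u) (hcoord_th (geodesic P N d u)) = geodesic P N d u.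
Proof.
have [[u0 V0]|V0] := pselect (exists u0, (geodesic P N d u0).2 = 0); last first.
  have Vn0 u : (geodesic P N d u).2 != 0 by apply/eqP => e; apply: V0; exists u.
  exists (fun u => hcoord_x (geodesic P N d u)); last first.
    by move=> u; apply: hpt_surj; exact: geodesic_hyperboloid.
  have eC : C1f (fun u => enorm (geodesic P N d u).2).
    apply: C1f_sqrt; first by move=> u; exact: dot_gt0.
    have -> : (fun u => dot (geodesic P N d u).2 (geodesic P N d u).2) =
        fun u => -1 + (1 + dot (geodesic P N d u).2 (geodesic P N d u).2).
      by apply/funext => u; ring.
    rewrite (funext (fun u => congr1 (+%R (-1)) (hyperboloid_dot (geodesic_hyperboloid u)))).
    apply: (C1f_add (C1f_cst _)).
    have c1 := C1f_geodesic P.1.1 N.1.1; have c2 := C1f_geodesic P.1.2 N.1.2.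
    apply: (C1f_add (C1f_mul c1 c1)).
    by apply: (C1f_mul (C1f_cst (-1))); exact: (C1f_mul c2 c2).
  apply: C1f_C1 => i.
  have -> : (fun u => hcoord_x (geodesic P N d u) 0 i) = fun u =>
      asinh (enorm (geodesic P N d u).2) * ((enorm (geodesic P N d u).2)^-1 *
        (cosh (d * u) * P.2 0 i + sinh (d * u) * N.2 0 i)).
    by apply/funext => u; rewrite !mxE.
  apply: (C1f_mul (C1f_comp C1f_asinh eC)); apply: C1f_mul; last exact: C1f_geodesic.
  by apply: C1f_inv => // u; rewrite enorm_eq0.
pose k := sinh (d * u0) / cosh (d * u0).
have P2 : P.2 = - k *: N.2.
  have c0 : cosh (d * u0) != 0 by rewrite gt_eqF// cosh_gt0.
  apply: (scalerI c0); rewrite scalerA; apply/eqP; rewrite -subr_eq0 -scaleNr.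
  have -> : - (cosh (d * u0) * - k) = sinh (d * u0) by rewrite /k; field.
  by apply/eqP; exact: V0.
pose w := (enorm N.2)^-1 *: N.2.
pose f u := cosh (d * u) * (- k * enorm N.2) + sinh (d * u) * enorm N.2.
have w1 : enorm w = 1 \/ w = 0.
  have [e|h] := eqVneq N.2 0; [by right; rewrite /w e scaler0|left].
  by rewrite enormZ normrV ?unitfE ?enorm_eq0// ger0_norm ?enorm_ge0// mulVf// enorm_eq0.
have Nw : enorm N.2 *: w = N.2.
  have [e|h] := eqVneq N.2 0; first by rewrite /w e !scaler0.
  by rewrite scalerA divff ?scale1r// enorm_eq0.
have V2 u : (geodesic P N d u).2 = sinh (asinh (f u)) *: w.
  rewrite asinhK /= P2 -{1 2}Nw !scalerA -scalerDl; congr (_ *: _).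
  by rewrite /f; ring.
exists (fun u => asinh (f u) *: w); last first.
  by move=> u; apply: hpt_polar => //; exact: geodesic_hyperboloid.
apply: C1f_C1 => i.
have -> : (fun u => (asinh (f u) *: w) 0 i) = fun u => asinh (f u) * w 0 i.
  by apply/funext => u; rewrite mxE.
by apply: (C1f_mul (C1f_comp C1f_asinh (C1f_geodesic _ _)) (C1f_cst _)).
Qed.

End Geodesic.
End Geodesics.

Section UpperBound.
Context {R : realType}.
Variables (n : nat) (lambda : R).
Hypothesis lambda_gt0 : 0 < lambda.

Lemma C1_cpt (th : R -> R) : C1f th -> C1 (fun u => cpt lambda (th u)) /\
  forall u w : R, is_derive u 1 th w ->
    dot (velocity (fun u => cpt lambda (th u)) u) (velocity (fun u => cpt lambda (th u)) u) = w ^+ 2.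
Proof.
move=> thC; have tl : C1f (fun u => th u / lambda) by exact: (C1f_mul thC (C1f_cst _)).
split.
  apply: C1f_C1 => -[[|[|//]] i2].
    under eq_fun do rewrite mxE /=.
    exact: (C1f_mul (C1f_cst _) (C1f_comp C1f_cos tl)).
  under eq_fun do rewrite mxE /=.
  exact: (C1f_mul (C1f_cst _) (C1f_comp C1f_sin tl)).
move=> u w thw.
have dl := der_mul thw (der_cst lambda^-1 u).
have dc := der_mul (der_cst lambda u) (der_comp (g := fun u => th u / lambda) (is_derive_cos _) dl).
have ds := der_mul (der_cst lambda u) (der_comp (g := fun u => th u / lambda) (is_derive_sin _) dl).
rewrite dot2E !mxE !derive1E.
rewrite (funext (fun v => cpt0E lambda (th v))) (funext (fun v => cpt1E lambda (th v))).
have [_ ->] := dc; have [_ ->] := ds.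
have l0 : lambda != 0 by rewrite gt_eqF.
transitivity (w ^+ 2 * (cos (th u / lambda) ^+ 2 + sin (th u / lambda) ^+ 2)).
  by field.
by rewrite cos2Dsin2 mulr1.
Qed.

(** The geodesic of hyperbolic space between two lifts, read in Fermi coordinates, projects
   to a [C1] arc of constant speed [d]. *)
Lemma joined_geodesic (p q : X n lambda) x0 th0 x1 th1 (d : R) :
  sval p = (x0, cpt lambda th0) -> sval q = (x1, cpt lambda th1) -> 0 <= d ->
  - eta (hpt x0 th0) (hpt x1 th1) = cosh d -> joined p q d.
Proof.
move=> pE qE d0.
have hP := hpt_hyperboloid x0 th0; have hQ := hpt_hyperboloid x1 th1.
set P := hpt x0 th0 in hP *; set Q := hpt x1 th1 in hQ *.
move=> PQd; have PQ : eta P Q = - cosh d by rewrite -PQd opprK.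
have [PP _] := hP; have [QQ _] := hQ.
have [dE|dn0] := eqVneq d 0.
  have e : lincomb 1 P (-1) Q = (0, 0, 0).
    apply: (tangent_eq0 hP); first by rewrite eta_lcl PP (etaC Q) PQ dE cosh0; ring.
    by rewrite (eta_sub hP hQ) PQ dE cosh0; ring.
  have PQe : P = Q by exact: lc_sub_eq0.
  have -> : q = p.
    apply: val_inj; rewrite /= pE qE.
    by have [-> ->] := hpt_inj PQe.
  by rewrite dE; exact: joined_nil.
have dp : 0 < d by rewrite lt_neqAle eq_sym dn0.
have s0 : sinh d != 0 by rewrite gt_eqF// sinh_gt0.
pose N := lincomb (sinh d)^-1 Q (- (cosh d / sinh d)) P.
have NP : eta N P = 0 by rewrite eta_lcl PP (etaC Q) PQ; field.
have NN : eta N N = 1.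
  rewrite !eta_lcl !eta_lcr PP QQ (etaC Q P) PQ.
  transitivity ((cosh d ^+ 2 - 1) / sinh d ^+ 2); first by field.
  by rewrite cosh2E addrAC subrr add0r divff// expf_neq0.
have V0 : geodesic P N d 0 = P.
  rewrite /geodesic mulr0 cosh0 sinh0 /lincomb !mul1r !mul0r !addr0 scale1r scale0r addr0.
  by case: (P) => [[]].
have V1 : geodesic P N d 1 = Q.
  by rewrite /geodesic mulr1 lc_endpoint.
move: N NP NN V0 V1 => N NP NN V0 V1.
have [x xC xV] := geodesic_coord d hP NP NN.
pose th u := hcoord_th (geodesic P N d u).
have thC : C1f th by exact: C1f_hcoord_th.
have [yC yv] := C1_cpt thC.
pose y u := cpt lambda (th u).
have arc : C1_arc x y p q.
  split => //.
  - by move=> u _; exact: enorm_cpt.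
  - have := xV 0; rewrite -/(th 0) V0 => /hpt_inj[ex et].
    by rewrite /y pE ex et.
  - have := xV 1; rewrite -/(th 1) V1 => /hpt_inj[ex et].
    by rewrite /y qE ex et.
have len : arc_length x y = d.
  rewrite /arc_length.
  have -> : (fun u => Num.sqrt (gplus (x u) (velocity x u) (velocity y u))) = fun=> d.
    apply/funext => u.
    case: (thC) => dth thd _.
    have [A [A1 A2 A3 gA]] := der_hpt (C1_derc u xC) (thd u).
    have QA : is_derive_mink (fun t => hpt (x t) (th t)) u A by split.
    rewrite (funext xV) in QA.
    rewrite (gA _ (yv u _ (thd u))) (mink_derE QA (derm_geodesic P N d u)).
    rewrite !eta_lcl !eta_lcr PP NN NP (etaC P N) NP.
    rewrite -[RHS](ger0_norm d0) -sqrtr_sqr; congr Num.sqrt.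
    transitivity (d ^+ 2 * (cosh (d * u) ^+ 2 - sinh (d * u) ^+ 2)); first by ring.
    by rewrite cosh2E; ring.
  rewrite Rintegral_cst//.
  have -> : fine (@lebesgue_measure R `[0, 1]) = 1; last by rewrite mulr1.
  by rewrite lebesgue_measure_itv/= lte_fin ltr01 oppr0 adde0.
by rewrite -[d]addr0 -len; apply: joined_cons arc (joined_nil q).
Qed.

End UpperBound.

(** * Distances and spheres of the quotient *)

Section Distance.
Context {R : realType}.
Variables (n : nat) (lambda : R).
Hypothesis lambda_gt0 : 0 < lambda.
Local Notation X := (@X R n lambda).
Local Notation cpt := (cpt lambda).
Local Notation M := (pi * lambda).
Implicit Types (p q r : X) (x : 'rV[R]_n) (th d : R).

Definition is_lift p x th := sval p = (x, cpt th).

Lemma lift_exists p : exists x th, `|th| <= M /\ is_lift p x th.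
Proof.
have /eqP yl := svalP p; have [th h e] := cpt_surj lambda_gt0 yl.
by exists (sval p).1, th; split => //; rewrite /is_lift -e -surjective_pairing.
Qed.

Lemma pt_subproof x th : enorm (x, cpt th).2 == lambda.
Proof. by rewrite enorm_cpt. Qed.

Definition pt x th : X := exist _ (x, cpt th) (pt_subproof x th).

Lemma pt_lift x th : is_lift (pt x th) x th.
Proof. by []. Qed.

Lemma lift_pt p x th : is_lift p x th -> p = pt x th.
Proof. by move=> h; apply: val_inj. Qed.

Lemma M_gt0 : 0 < M.
Proof. by rewrite mulr_gt0// pi_gt0. Qed.

Lemma cpt_eq_norm th th' : `|th| <= M -> cpt th' = cpt th -> `|th| <= `|th'|.
Proof.
move=> h e; rewrite leNgt; apply/negP => lt.
have l0 : lambda != 0 by rewrite gt_eqF.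
have H t : `|t| <= M -> `|t / lambda| \in `[0, pi].
  move=> tM; rewrite in_itv/= normr_ge0/= normrM normrV ?unitfE//.
  by rewrite (gtr0_norm lambda_gt0) ler_pdivrMr.
have cosn (t : R) : cos `|t| = cos t by case: (ger0P t) => // _; rewrite cosN.
have ce : cos `|th' / lambda| = cos `|th / lambda|.
  by have := congr1 (fun v : 'rV[R]_2 => v 0 0) e; rewrite !cpt0E => /(mulfI l0); rewrite !cosn.
have := cos_inj (H _ (le_trans (ltW lt) h)) (H _ h) ce.
rewrite !normrM => /(mulIf _) E; move: lt; rewrite E ?ltxx//.
by rewrite normr_eq0 invr_eq0.
Qed.

Lemma cpt_eq_near th th' : `|th' - th| < 2 * M -> cpt th' = cpt th -> th' = th.
Proof.
move=> h e; have l0 : lambda != 0 by rewrite gt_eqF.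
have c := congr1 (fun v : 'rV[R]_2 => v 0 0) e; rewrite !cpt0E in c; move/(mulfI l0) in c.
have s := congr1 (fun v : 'rV[R]_2 => v 0 1) e; rewrite !cpt1E in s; move/(mulfI l0) in s.
have cd : cos ((th' - th) / lambda) = 1.
  by rewrite mulrBl cosB c s -!expr2 cos2Dsin2.
pose a := `|th' - th| / lambda / 2.
have ca : cos (a + a) = 1.
  rewrite /a -splitr; case: (ger0P (th' - th)) => _; first exact: cd.
  by rewrite mulNr cosN cd.
have sa : sin a = 0.
  move: ca; rewrite cosD -!expr2; have := cos2Dsin2 a => h1 h2.
  by apply/eqP; rewrite -sqrf_eq0; apply/eqP; lra.
have a_lt : a < pi.
  by rewrite /a ltr_pdivrMr// ltr_pdivrMr// (lt_le_trans h)//; lra.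
apply/eqP; rewrite -subr_eq0 -normr_eq0; apply/negPn/negP => n0.
have a0 : 0 < a by rewrite !divr_gt0// lt_neqAle eq_sym n0 normr_ge0.
by have := @sin_gt0_pi R a; rewrite a0 a_lt sa ltxx => /(_ isT).
Qed.

Lemma joined_trans p q r (l l' : R) : joined p q l -> joined q r l' -> joined p r (l + l').
Proof.
move=> j; elim: j => {p q l} [p|p q q' x y l a _ IH] h; first by rewrite add0r.
by rewrite -addrA; apply: joined_cons a (IH h).
Qed.

Lemma riem_dist_lbound p q : has_lbound [set l | joined p q l].
Proof. by exists 0 => l; exact: joined_ge0. Qed.

Lemma joined_exists p q : exists l : R, joined p q l.
Proof.
have [x0 [th0 [_ pE]]] := lift_exists p; have [x1 [th1 [_ qE]]] := lift_exists q.
have [d d0 dE] := exists_acosh (eta_hpt_ge1 x0 th0 x1 th1).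
by exists d; exact: (joined_geodesic lambda_gt0 pE qE d0 (esym dE)).
Qed.

Lemma joined_of_riem_dist_lt p q a : riem_dist p q < a -> exists2 l : R, joined p q l & l < a.
Proof. by apply: inf_lt; have [l] := joined_exists p q; exists l. Qed.

Lemma riem_dist_le_lift p q x0 th0 x1 th1 d : is_lift p x0 th0 -> is_lift q x1 th1 ->
  0 <= d -> - eta (hpt x0 th0) (hpt x1 th1) <= cosh d -> riem_dist p q <= d.
Proof.
move=> pE qE d0 h; have [e e0 eE] := exists_acosh (eta_hpt_ge1 x0 th0 x1 th1).
apply: (@le_trans _ _ e); last by rewrite -ler_cosh_pos// eE.
apply: ge_inf; first exact: riem_dist_lbound.
exact: joined_geodesic pE qE e0 (esym eE).
Qed.

Lemma riem_dist_lt_lift p q x0 th0 a : is_lift p x0 th0 -> riem_dist p q < a ->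
  exists x1 th1 l, [/\ is_lift q x1 th1, 0 <= l, l < a &
    - eta (hpt x0 th0) (hpt x1 th1) <= cosh l].
Proof.
move=> pE /joined_of_riem_dist_lt[l j la].
have [x1 [th1 [qE h]]] := joined_lift lambda_gt0 j pE.
by exists x1, th1, l; split => //; exact: joined_ge0 j.
Qed.

Lemma riem_distC p q : riem_dist p q = riem_dist q p.
Proof.
suff H p' q' : riem_dist p' q' <= riem_dist q' p' by apply/eqP; rewrite eq_le !H.
rewrite leNgt; apply/negP => lt.
have [x1 [th1 [_ qE]]] := lift_exists q'.
have [x0 [th0 [l [pE l0 la h]]]] := riem_dist_lt_lift qE lt.
by have := riem_dist_le_lift pE qE l0; rewrite etaC => /(_ h); rewrite leNgt la.
Qed.

Lemma riem_dist_lt_add p q r a b : riem_dist p q < a -> riem_dist q r < b ->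
  riem_dist p r < a + b.
Proof.
move=> /joined_of_riem_dist_lt[l j la] /joined_of_riem_dist_lt[l' j' lb].
apply: (@le_lt_trans _ _ (l + l')); last by rewrite ltrD.
by apply: ge_inf; [exact: riem_dist_lbound|exact: joined_trans j j'].
Qed.

(** The slab [|th| <= M] is the Dirichlet domain of every point with [th = 0]: among the
   lifts of [q], the one with smallest [|th|] is the closest. *)
Lemma riem_dist_slab p q x0 x1 th1 d : is_lift p x0 0 -> is_lift q x1 th1 ->
  `|th1| <= M -> 0 <= d -> - eta (hpt x0 0) (hpt x1 th1) = cosh d -> riem_dist p q = d.
Proof.
move=> pE qE thM d0 dE; apply/eqP; rewrite eq_le.
rewrite (riem_dist_le_lift pE qE d0) ?dE//= leNgt; apply/negP => lt.
have [x1' [th1' [l [qE' l0 ld h]]]] := riem_dist_lt_lift pE lt.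
move: qE'; rewrite /is_lift qE => -[ex eth].
have nth := cpt_eq_norm thM (esym eth).
have : cosh d <= cosh l.
  apply: le_trans h; rewrite -dE -ex !eta_hpt !sub0r !coshN lerB//.
  rewrite ler_wpM2l//; first by rewrite mulr_ge0// ltW// cosh_gt0.
  by rewrite -(cosh_norm th1) -(cosh_norm th1') ler_cosh_pos.
by rewrite ler_cosh_pos// leNgt ld.
Qed.

(** A curve between two points at depth [g] inside the slab that ends at another lift has
   to change [th] by at least [2 * g]; so for close points it is no shortcut. *)
Lemma riem_dist_local p q x0 th0 x1 th1 g d : is_lift p x0 th0 -> is_lift q x1 th1 ->
  `|th0| <= M - g -> `|th1| <= M - g -> riem_dist p q < 2 * g ->
  0 <= d -> - eta (hpt x0 th0) (hpt x1 th1) = cosh d -> riem_dist p q = d.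
Proof.
move=> pE qE th0M th1M pqg d0 dE; apply/eqP; rewrite eq_le.
rewrite (riem_dist_le_lift pE qE d0) ?dE//= leNgt; apply/negP => lt.
have lt2 : riem_dist p q < Num.min d (2 * g) by rewrite lt_min lt.
have [x1' [th1' [l [qE' l0]]]] := riem_dist_lt_lift pE lt2.
rewrite lt_min => /andP[ld lg] h.
move: qE'; rewrite /is_lift qE => -[ex eth].
have th01 : `|th0 - th1'| <= l.
  by rewrite -ler_cosh_pos// cosh_norm (le_trans _ h)// cosh_le_eta_hpt.
have e : th1' = th1.
  apply: cpt_eq_near (esym eth).
  have -> : th1' - th1 = (th0 - th1) - (th0 - th1') by ring.
  apply: (le_lt_trans (ler_normB _ _)).
  by have := ler_normB th0 th1; lra.
move: h; rewrite e -ex dE ler_cosh_pos//.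
by rewrite leNgt ld.
Qed.

(** The boundary of a ball is the sphere. From the inside it is approached along the
   geodesic to the centre; its own points are outside of the open ball. *)
Lemma boundary_ball p x0 s : is_lift p x0 0 -> 0 < s ->
  boundary (geodesic_ball p s) = [set q | exists x1 th1,
    [/\ is_lift q x1 th1, `|th1| <= M & - eta (hpt x0 0) (hpt x1 th1) = cosh s]].
Proof.
move=> pE s0; apply/seteqP; split => q /=.
  move=> bq; have [x1 [th1 [thM qE]]] := lift_exists q.
  have [d d0 dE] := exists_acosh (eta_hpt_ge1 x0 0 x1 th1).
  have pq := riem_dist_slab pE qE thM d0 (esym dE).
  exists x1, th1; split => //; rewrite -dE; congr cosh; rewrite -pq.
  apply/eqP; rewrite eq_le; apply/andP; split; rewrite leNgt; apply/negP => lt.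
    have e0 : 0 < riem_dist p q - s by rewrite subr_gt0.
    have [[r [qr pr]] _] := bq _ e0; rewrite riem_distC in qr.
    by have := riem_dist_lt_add pr qr; rewrite addrC subrK ltxx.
  have e0 : 0 < s - riem_dist p q by rewrite subr_gt0.
  have [_ [r [qr pr]]] := bq _ e0; apply: pr.
  have [a /andP[a1 a2]] : exists a, riem_dist p q < a < s - riem_dist q r.
    exists ((riem_dist p q + (s - riem_dist q r)) / 2).
    by apply/andP; split; lra.
  have -> : s = a + (s - a) by ring.
  by apply: (@riem_dist_lt_add p q r) => //; lra.
move=> [x1 [th1 [qE thM dE]]].
have pq := riem_dist_slab pE qE thM (ltW s0) dE.
move=> e e0; split; last first.
  exists q; split; last by rewrite /geodesic_ball /= pq ltxx.
  apply: le_lt_trans e0; apply: (riem_dist_le_lift qE qE) => //.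
  by have [-> _] := hpt_hyperboloid x1 th1; rewrite opprK cosh0.
pose t := Num.min (e / 2) (s / 2).
have t0 : 0 < t by rewrite lt_min !divr_gt0.
have te : t < e by apply: (@le_lt_trans _ _ (e / 2)); [rewrite ge_min lexx|lra].
have ts : t < s by apply: (@le_lt_trans _ _ (s / 2)); [rewrite ge_min lexx orbT|lra].
have hP := hpt_hyperboloid x0 0; have hQ := hpt_hyperboloid x1 th1.
set P := hpt x0 0 in dE hP; set Q := hpt x1 th1 in dE hQ.
have [PP P0] := hP; have [QQ Q0] := hQ.
have PQ : eta P Q = - cosh s by rewrite -dE opprK.
have ss : sinh s != 0 by rewrite gt_eqF// sinh_gt0.
pose V := lincomb (sinh t / sinh s) P (sinh (s - t) / sinh s) Q.
have PV : eta P V = - cosh (s - t).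
  rewrite eta_lcr PP PQ; apply: (mulfI ss).
  have {1}-> : t = s - (s - t) by ring.
  by rewrite (sinhB s (s - t)); field.
have QV : eta Q V = - cosh t.
  rewrite eta_lcr (etaC Q P) PQ QQ; apply: (mulfI ss).
  by rewrite sinhB; field.
have hV : hyperboloid V.
  split; last first.
    by rewrite /V /= addr_gt0// mulr_gt0// divr_gt0// sinh_gt0// subr_gt0.
  rewrite {1}/V eta_lcl PV QV; apply: (mulfI ss).
  transitivity (- sinh (t + (s - t))); first by rewrite sinhD; field.
  by rewrite addrC subrK mulrN1.
have rE := pt_lift (hcoord_x V) (hcoord_th V).
exists (pt (hcoord_x V) (hcoord_th V)); split.
  apply: le_lt_trans te; apply: (riem_dist_le_lift qE rE); first exact: ltW.
  by rewrite hpt_surj// QV opprK.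
rewrite /geodesic_ball /=; apply: (@le_lt_trans _ _ (s - t)); last by lra.
apply: (riem_dist_le_lift pE rE); first by lra.
by rewrite hpt_surj// PV opprK.
Qed.

End Distance.

(** * Monotonicity of the volume of spheres *)

Section Monotonicity.
Context {R : realType}.
Variables (n : nat) (lambda : R).
Hypothesis lambda_gt0 : 0 < lambda.
Local Notation X := (@X R n lambda).
Local Notation M := (pi * lambda).
Local Notation pt := (pt lambda_gt0).

(** Cauchy-Schwarz for the last components, which are dominated by the time component. The
   bound makes the contraction of the spheres below uniform. *)
Lemma time_bound (x0 x1 : 'rV[R]_n) th1 s : - eta (hpt x0 0) (hpt x1 th1) = cosh s ->
  (hpt x1 th1).1.1 <= cosh s / (cosh (enorm x0) - sinh (enorm x0)).
Proof.
move=> h; rewrite ler_pdivlMr ?coshBsinh_gt0// mulrC.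
have hQ := hyperboloid_sqr (hpt_hyperboloid x1 th1).
have Q0 : 0 < (hpt x1 th1).1.1 by have [] := hpt_hyperboloid x1 th1.
set Q := hpt x1 th1 in h hQ Q0 *.
have cs := dot_le_enorm (hpt x0 0).2 Q.2.
have e0 : enorm (hpt x0 0).2 = sinh (enorm x0).
  by rewrite /enorm dot_hpt2 sqrtr_sqr ger0_norm// sinh_ge0 enorm_ge0.
have eQ : enorm Q.2 <= Q.1.1.
  rewrite -(@ler_pXn2r _ 2)// ?nnegrE ?enorm_ge0 ?(ltW Q0)// enorm_sqr hQ.
  by have := sqr_ge0 Q.1.2; lra.
have s0 : 0 <= sinh (enorm x0) by rewrite sinh_ge0 enorm_ge0.
have : sinh (enorm x0) * enorm Q.2 <= sinh (enorm x0) * Q.1.1 by rewrite ler_wpM2l.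
rewrite e0 in cs; move: h; rewrite /eta {1 2 3}/hpt /= cosh0 sinh0.
rewrite -/Q in cs; move: cs; rewrite /=; lra.
Qed.

(** Contracting a sphere to a concentric one along the geodesics to the centre maps the
   slab well inside of itself, and multiplies chord lengths by the ratio of the [sinh]
   of the radii. Hence the volume of a sphere divided by [sinh s ^ n] decreases. *)
Lemma sphere_volume_mono (p : X) x0 s1 s2 : is_lift p x0 0 -> 0 < s1 -> s1 < s2 ->
  (sphere_volume p s2 <= ((sinh s2 / sinh s1) ^+ n)%:E * sphere_volume p s1)%E.
Proof.
move=> pE s10 s12; have s20 : 0 < s2 by exact: lt_trans s12.
have sh1 : 0 < sinh s1 by rewrite sinh_gt0.
have sh2 : 0 < sinh s2 by rewrite sinh_gt0.
have sh1n : sinh s1 != 0 by rewrite gt_eqF.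
have sh2n : sinh s2 != 0 by rewrite gt_eqF.
(* [k Q + m P] is the point at distance [s1] from [P] on the geodesic to [Q] *)
pose k := sinh s1 / sinh s2; pose m := sinh (s2 - s1) / sinh s2.
have k0 : 0 < k by rewrite divr_gt0.
have m0 : 0 < m by rewrite divr_gt0// sinh_gt0 subr_gt0.
have hP := hpt_hyperboloid x0 0; set P := hpt x0 0 in hP *; have [PP P0] := hP.
have mk : m + k * cosh s2 = cosh s1.
  by rewrite /m /k sinhB; field.
have kk : (m + k * cosh s2) ^+ 2 - k ^+ 2 * (cosh s2 ^+ 2 - 1) = 1.
  rewrite mk !cosh2E /k.
  have -> : 1 + sinh s2 ^+ 2 - 1 = sinh s2 ^+ 2 by ring.
  by field.
pose D := [set i : 'rV[R]_n * R | `|i.2| <= M /\ - eta P (hpt i.1 i.2) = cosh s2].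
pose V (i : 'rV[R]_n * R) := lincomb k (hpt i.1 i.2) m P.
have PV i : D i -> eta P (V i) = - cosh s1.
  move=> [_ /= e]; rewrite /V eta_lcr PP -mk -e; ring.
have VV i j : D i -> D j -> eta (V i) (V j) = k ^+ 2 * (eta (hpt i.1 i.2) (hpt j.1 j.2) + 1) - 1.
  move=> [_ /= ei] [_ /= ej]; rewrite /V !eta_lcl !eta_lcr PP (etaC _ P).
  have -> : eta P (hpt i.1 i.2) = - cosh s2 by rewrite -ei opprK.
  have -> : eta P (hpt j.1 j.2) = - cosh s2 by rewrite -ej opprK.
  by move: kk; set h := eta _ _; lra.
have hV i : D i -> hyperboloid (V i).
  move=> Di; split.
    rewrite VV//; have [-> _] := hpt_hyperboloid i.1 i.2; ring.
  by have [_ h] := hpt_hyperboloid i.1 i.2; rewrite /V /= addr_gt0// mulr_gt0.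
pose T := cosh s2 / (cosh (enorm x0) - sinh (enorm x0)).
have T0 : 0 < T by rewrite divr_gt0 ?coshBsinh_gt0// cosh_gt0.
pose rho := k * T / (k * T + m).
have den : 0 < k * T + m by rewrite addr_gt0// mulr_gt0.
have rho0 : 0 <= rho by rewrite divr_ge0 ?(ltW den)// mulr_ge0// ltW.
have rho1 : rho < 1 by rewrite ltr_pdivrMr// mul1r ltrDl.
have M0 : 0 < M by exact: M_gt0.
pose g := asinh ((1 - rho) * sinh M).
have g0 : 0 < g by rewrite asinh_gt0 mulr_gt0 ?sinh_gt0// subr_gt0.
have slab i : D i -> `|hcoord_th (V i)| <= M - g.
  move=> Di; suff H : cosh M * `|(V i).1.2| <= rho * (sinh M * (V i).1.1).
    apply: (slab_bound (ltW M0) rho0 (ltW rho1) (x := hcoord_x (V i))).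
    by rewrite hpt_surj//; exact: hV.
  have [iM ei] := Di; have tb := time_bound ei.
  have cone := slab_cone i.1 iM.
  have Q0 : 0 < (hpt i.1 i.2).1.1 by have [] := hpt_hyperboloid i.1 i.2.
  have -> : (V i).1.2 = k * (hpt i.1 i.2).1.2 by rewrite /V /= sinh0; ring.
  have -> : (V i).1.1 = k * (hpt i.1 i.2).1.1 + m * cosh (enorm x0).
    by rewrite /V /= cosh0 mulr1.
  rewrite normrM (gtr0_norm k0) mulrCA.
  apply: (@le_trans _ _ (k * (sinh M * (hpt i.1 i.2).1.1))).
    by rewrite ler_pM2l.
  rewrite mulrCA [leRHS]mulrCA ler_pM2l ?sinh_gt0//.
  rewrite /rho [leRHS]mulrC [leRHS]mulrA ler_pdivlMr//.
  have c1 := cosh_ge1 (enorm x0).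
  move: (hpt i.1 i.2).1.1 tb Q0 => q qT q0; rewrite -/T in qT.
  have h1 : m * (k * q) <= m * (k * T) by rewrite !ler_pM2l.
  have h2 : m * (k * T) * 1 <= m * (k * T) * cosh (enorm x0).
    by rewrite ler_pM2l// mulr_gt0// mulr_gt0.
  lra.
(* the contracted point and the original one, indexed by the coordinates of the latter *)
pose a i := pt (hcoord_x (V i)) (hcoord_th (V i)).
pose b (i : 'rV[R]_n * R) := pt i.1 i.2.
have K0 : 0 < sinh s2 / sinh s1 by rewrite divr_gt0.
apply: (@le_trans _ _ (hausdorff_measure (@riem_dist R n lambda) n (b @` D))).
  apply: hausdorff_measure_mono; rewrite (boundary_ball lambda_gt0 pE s20).
  move=> q [x1 [th1 [qE thM e]]]; exists (x1, th1) => //.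
  by apply/esym; exact: lift_pt qE.
apply: (@le_trans _ _ (((sinh s2 / sinh s1) ^+ n)%:E *
    hausdorff_measure (@riem_dist R n lambda) n (a @` D)))%E; last first.
  rewrite lee_wpmul2l ?lee_fin ?exprn_ge0 ?(ltW K0)//.
  apply: hausdorff_measure_mono; rewrite (boundary_ball lambda_gt0 pE s10).
  move=> _ [i Di <-]; exists (hcoord_x (V i)), (hcoord_th (V i)); split => //.
    by have := slab i Di; lra.
  by rewrite hpt_surj ?PV ?opprK//; exact: hV.
apply: (@hausdorff_measure_lipschitz _ _ _ _ _ _ _ _ _ _ (2 * g)) => //.
  by rewrite mulr_gt0.
move=> i j Di Dj lt.
have hc := eta_hyperboloid_le (hV i Di) (hV j Dj).
have [d d0 dE] := exists_acosh hc.
have dab : riem_dist (a i) (a j) = d.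
  apply: (riem_dist_local lambda_gt0 (pt_lift lambda_gt0 _ _) (pt_lift lambda_gt0 _ _)
    (slab i Di) (slab j Dj) lt d0).
  by rewrite !hpt_surj ?dE//; exact: hV.
rewrite dab; apply: (riem_dist_le_lift lambda_gt0 (pt_lift lambda_gt0 _ _) (pt_lift lambda_gt0 _ _)).
  by rewrite mulr_ge0// ltW.
have K1 : 1 <= sinh s2 / sinh s1 by rewrite ler_pdivlMr// mul1r ler_sinh ltW.
have := coshB1_scale K1 d0; rewrite dE VV// => h.
have -> : - eta (hpt i.1 i.2) (hpt j.1 j.2) = 1 +
    (sinh s2 / sinh s1) ^+ 2 * (- (k ^+ 2 * (eta (hpt i.1 i.2) (hpt j.1 j.2) + 1) - 1) - 1).
  by rewrite /k; field; rewrite sh1n sh2n.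
lra.
Qed.

End Monotonicity.

(** * Spheres far from the axis *)

Section LowerVolume.
Context {R : realType}.
Variables (n' : nat) (lambda : R).
Hypothesis lambda_gt0 : 0 < lambda.
Local Notation n := n'.+1.
Local Notation X := (@X R n lambda).
Local Notation M := (pi * lambda).
Local Notation pt := (pt lambda_gt0).

(** A patch of the sphere of radius [s] about the point at distance [t0] from the axis, as a
   graph over the cube: the [z m / n] are the coordinates orthogonal to the radial direction,
   and [xi z >= 0] is the radial one, pointing away from the axis. *)
Definition xi (z : nat -> R) := Num.sqrt (1 - \sum_(m < n) (z m / n%:R) ^+ 2).

Definition cap (t0 s : R) (z : nat -> R) : mink R n :=
  (cosh s * cosh t0 + sinh s * xi z * sinh t0,
   sinh s * (z 0%N / n%:R),
   \row_i (if i == 0 then cosh s * sinh t0 + sinh s * xi z * cosh t0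
           else sinh s * (z i / n%:R))).

Lemma eta_cap t0 s z z' : eta (cap t0 s z) (cap t0 s z') =
  - cosh s ^+ 2 + sinh s ^+ 2 *
    (xi z * xi z' + \sum_(m < n) (z m / n%:R) * (z' m / n%:R)).
Proof.
rewrite /eta /cap /= /dot big_ord_recl !mxE /= [in RHS]big_ord_recl /=.
have -> : \sum_(i < n') (\row_i0 (if i0 == 0 then cosh s * sinh t0 + sinh s * xi z * cosh t0
           else sinh s * (z i0 / n%:R))) 0 (lift ord0 i) * (\row_i0 (if i0 == 0 then cosh s * sinh t0 + sinh s * xi z' * cosh t0
           else sinh s * (z' i0 / n%:R))) 0 (lift ord0 i) =
    sinh s ^+ 2 * \sum_(i < n') z (lift ord0 i) / n%:R * (z' (lift ord0 i) / n%:R).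
  by rewrite mulr_sumr; apply: eq_bigr => i _; rewrite !mxE /=; ring.
set A := \sum_(i < n') _.
have := cosh2E t0; set c0 := cosh t0; set S0 := sinh t0 => e.
transitivity ((S0 ^+ 2 - c0 ^+ 2) * (cosh s ^+ 2 - sinh s ^+ 2 * (xi z * xi z')) +
   sinh s ^+ 2 * (z 0%N / n%:R * (z' 0%N / n%:R) + A)); first by ring.
by rewrite e; ring.
Qed.

Definition e0 : 'rV[R]_n := delta_mx 0 0.

Lemma enorm_e0 : enorm e0 = 1.
Proof.
rewrite /enorm /dot big_ord_recl big1 ?addr0 => [|i _].
  by rewrite !mxE !eqxx mulr1 sqrtr1.
by rewrite !mxE /= mul0r.
Qed.

Lemma hpt_e0 t0 : 0 <= t0 -> hpt (t0 *: e0) 0 = (cosh t0, 0, sinh t0 *: e0).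
Proof.
move=> t00; rewrite /hpt sinhc_scale; last by left; exact: enorm_e0.
by rewrite enormZ enorm_e0 mulr1 ger0_norm// cosh0 sinh0 mulr1 mulr0.
Qed.

Lemma eta_center_cap t0 s z : 0 <= t0 -> eta (hpt (t0 *: e0) 0) (cap t0 s z) = - cosh s.
Proof.
move=> t00; rewrite hpt_e0// /eta /= dotZl /dot big_ord_recl big1 => [|i _].
  rewrite !mxE !eqxx /=; have := cosh2E t0; set c0 := cosh t0; set S0 := sinh t0 => e.
  transitivity ((S0 ^+ 2 - c0 ^+ 2) * cosh s); first by ring.
  by rewrite e; ring.
by rewrite !mxE /= mul0r.
Qed.

Definition cube := [set z : nat -> R | forall m, 0 <= z m <= 1].

Lemma xi_sqr z : cube z -> xi z ^+ 2 + \sum_(m < n) (z m / n%:R) ^+ 2 = 1.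
Proof.
move=> zc; rewrite sqr_sqrtr ?subrK// subr_ge0.
apply: (@le_trans _ _ (\sum_(m < n) n%:R^-1)).
  apply: ler_sum => m _; have /andP[z0 z1] := zc m.
  have n1 : (n%:R^-1 : R) <= 1 by rewrite invf_le1// ler1n.
  have n0 : 0 < (n%:R^-1 : R) by rewrite invr_gt0.
  rewrite expr2; apply: (@le_trans _ _ (1 * (1 * n%:R^-1))); last by rewrite !mul1r.
  apply: ler_pM => //; rewrite ?mulr_ge0 ?(ltW n0)//.
    by rewrite -[leRHS]mulr1 ler_pM// ltW.
  by rewrite ler_wpM2r// ltW.
by rewrite sumr_const card_ord -[_ *+ _]mulr_natl mulfV// pnatr_eq0.
Qed.

(** When the slab is wide as seen from the centre, it contains the patch well inside, so that
   small distances on the patch are hyperbolic. They dominate chords up to a factor, hence the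
   projection of the patch to the cube is Lipschitz. *)
Lemma sphere_volume_ge (p : X) t0 s : is_lift p (t0 *: e0) 0 -> 0 <= t0 -> 0 < s ->
  2 * cosh M <= sinh M * cosh t0 ->
  ((hausdorff_cst n / (4 * n%:R) ^+ n * sinh s ^+ n)%:E <= sphere_volume p s)%E.
Proof.
move=> pE t00 s0 wide.
have sh0 : 0 < sinh s by rewrite sinh_gt0.
have M0 : 0 < M by exact: M_gt0.
have n0 : 0 < n%:R :> R by rewrite ltr0n.
have hV z : cube z -> hyperboloid (cap t0 s z).
  move=> zc; split.
    rewrite eta_cap; have := xi_sqr zc; under eq_bigr do rewrite expr2.
    by rewrite expr2 => ->; rewrite cosh2E; ring.
  rewrite /= ltr_wpDr ?(mulr_gt0 (cosh_gt0 _) (cosh_gt0 _))//.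
  by rewrite mulr_ge0 ?sinh_ge0// mulr_ge0 ?(ltW sh0)// sqrtr_ge0.
pose g := asinh ((1 - 2^-1) * sinh M).
have g0 : 0 < g by rewrite asinh_gt0 mulr_gt0 ?sinh_gt0//; lra.
have slab z : cube z -> `|hcoord_th (cap t0 s z)| <= M - g.
  move=> zc; have half0 : 0 <= 2^-1 :> R by [].
  apply: (slab_bound (ltW M0) half0 _ (x := hcoord_x (cap t0 s z))); first by lra.
  rewrite hpt_surj /=; last exact: hV.
  have /andP[z0 z1] := zc 0%N.
  rewrite ger0_norm; last by rewrite mulr_ge0 ?(ltW sh0)// divr_ge0// ltW.
  have zn : z 0%N / n%:R <= 1 by rewrite ler_pdivrMr// mul1r (le_trans z1)// ler1n.
  have c0 := cosh_gt0 M.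
  have h1 : sinh s * (z 0%N / n%:R) <= cosh s.
    apply: (@le_trans _ _ (sinh s)).
      by rewrite ler_piMr// ltW.
    by have := coshBsinh_gt0 s; lra.
  have h2 : cosh M * (sinh s * (z 0%N / n%:R)) <= cosh M * cosh s by rewrite ler_pM2l.
  have h3 : 2 * cosh M * cosh s <= sinh M * cosh t0 * cosh s by rewrite ler_pM2r ?cosh_gt0.
  have h4 : 0 <= sinh M * (sinh s * xi z * sinh t0).
    by rewrite mulr_ge0 ?sinh_ge0 ?(ltW M0)// mulr_ge0 ?sinh_ge0// mulr_ge0 ?(ltW sh0)// sqrtr_ge0.
  move: h2 h3 h4; set q := z 0%N / n%:R; lra.
pose a z := pt (hcoord_x (cap t0 s z)) (hcoord_th (cap t0 s z)).
apply: (@le_trans _ _ (hausdorff_measure (@riem_dist R n lambda) n (a @` cube))); last first.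
  apply: hausdorff_measure_mono; rewrite (boundary_ball lambda_gt0 pE s0).
  move=> _ [z zc <-]; exists (hcoord_x (cap t0 s z)), (hcoord_th (cap t0 s z)); split => //.
    by have := slab z zc; lra.
  by rewrite hpt_surj ?eta_center_cap ?opprK//; exact: hV.
have -> : hausdorff_cst n / (4 * n%:R) ^+ n * sinh s ^+ n =
    hausdorff_cst n / (2 * (2 * n%:R / sinh s)) ^+ n.
  have -> : 2 * (2 * n%:R / sinh s) = 4 * n%:R / sinh s by field; rewrite gt_eqF.
  have E (c u v : R) k : c / u ^+ k * v ^+ k = c / (u / v) ^+ k.
    by rewrite expr_div_n invf_div mulrAC mulrA.
  exact: E.
pose delta0 := Num.min (2 * g) 2^-1.
apply: (@hausdorff_measure_ge_cube _ _ _ _ a cube (fun z => z) (2 * n%:R / sinh s) delta0) => //.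
- by rewrite divr_gt0// mulr_gt0.
- by rewrite lt_min mulr_gt0//= invr_gt0.
- move=> z z' zc z'c lt m mn.
  have [d d0 dE] := exists_acosh (eta_hyperboloid_le (hV z zc) (hV z' z'c)).
  move: lt; rewrite lt_min => /andP[lt lt2].
  have dab : riem_dist (a z) (a z') = d.
    apply: (riem_dist_local lambda_gt0 (pt_lift lambda_gt0 _ _) (pt_lift lambda_gt0 _ _)
      (slab z zc) (slab z' z'c) lt d0).
    by rewrite !hpt_surj ?dE//; exact: hV.
  rewrite dab in lt2 *.
  have := @coshB1_le _ d; rewrite ger0_norm// => /(_ (ltW lt2)).
  rewrite dE eta_cap cosh2E => h.
  have x1 := xi_sqr zc; have x2 := xi_sqr z'c.
  have e1 : \sum_(i < n) (z i / n%:R - z' i / n%:R) ^+ 2 =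
      \sum_(i < n) (z i / n%:R) ^+ 2 + \sum_(i < n) (z' i / n%:R) ^+ 2
      - 2 * \sum_(i < n) (z i / n%:R) * (z' i / n%:R).
    rewrite mulr_sumr -big_split -sumrB /=; apply: eq_bigr => i _; ring.
  have e2 : (z m / n%:R - z' m / n%:R) ^+ 2 <= \sum_(i < n) (z i / n%:R - z' i / n%:R) ^+ 2.
    rewrite (bigD1 (Ordinal mn))//= lerDl; apply: sumr_ge0 => i _; exact: sqr_ge0.
  have e3 := sqr_ge0 (xi z - xi z').
  have key : sinh s ^+ 2 * (z m / n%:R - z' m / n%:R) ^+ 2 <= (2 * d) ^+ 2.
    have : sinh s ^+ 2 * (z m / n%:R - z' m / n%:R) ^+ 2 <= sinh s ^+ 2 *
        ((xi z - xi z') ^+ 2 + \sum_(i < n) (z i / n%:R - z' i / n%:R) ^+ 2).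
      by rewrite ler_pM2l ?exprn_gt0// (le_trans e2)// lerDr.
    rewrite e1; set A := \sum_(i < n) _ * _ in h *.
    have -> : (xi z - xi z') ^+ 2 + (\sum_(i < n) (z i / n%:R) ^+ 2 +
        \sum_(i < n) (z' i / n%:R) ^+ 2 - 2 * A) = 2 - 2 * (xi z * xi z' + A).
      by transitivity ((xi z ^+ 2 + \sum_(i < n) (z i / n%:R) ^+ 2) +
        (xi z' ^+ 2 + \sum_(i < n) (z' i / n%:R) ^+ 2) - 2 * (xi z * xi z' + A));
        [ring|rewrite x1 x2; ring].
    move: h; set B := xi z * xi z' + A; move: (_ ^+ 2 * (_ - _) ^+ 2) => t; lra.
  have -> : z m - z' m = (z m / n%:R - z' m / n%:R) * n%:R by field; rewrite gt_eqF.
  rewrite normrM (gtr0_norm n0).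
  have -> : 2 * n%:R / sinh s * d = 2 * d / sinh s * n%:R by field; rewrite gt_eqF.
  rewrite ler_pM2r// ler_pdivlMr// mulrC.
  rewrite -(@ler_pXn2r _ 2)// ?nnegrE ?(mulr_ge0 (ltW sh0) (normr_ge0 _)) ?(mulr_ge0 _ d0)//.
  by rewrite exprMn real_normK ?num_real.
- by move=> x x01; exists x.
Qed.

End LowerVolume.

(** * Spheres about points of the axis *)

Section UpperVolume.
Context {R : realType}.
Variables (n' : nat) (lambda : R).
Hypothesis lambda_gt0 : 0 < lambda.
Local Notation n := n'.+1.
Local Notation X := (@X R n lambda).
Local Notation M := (pi * lambda).

Lemma truncn_dist (a b : R) : 0 <= a -> 0 <= b -> Num.truncn a = Num.truncn b ->
  `|a - b| <= 1.
Proof.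
move=> a0 b0 e; have /andP[a1 a2] := truncn_itv a0; have /andP[b1 b2] := truncn_itv b0.
rewrite -e in b1 b2; rewrite -natr1 in a2 b2; rewrite ler_norml; lra.
Qed.

(** On the unit sphere, one coordinate is a Lipschitz function of the others as long as
   it is bounded away from [0]. *)
Lemma graph_bound (N c u u' : R) (w w' : 'rV[R]_n) (j : 'I_n) (sg : bool) :
  0 < N -> 0 < c ->
  u ^+ 2 + dot w w = 1 -> u' ^+ 2 + dot w' w' = 1 ->
  c <= (-1) ^+ sg * w 0 j -> c <= (-1) ^+ sg * w' 0 j ->
  `|u - u'| <= N^-1 -> (forall i, i != j -> `|w 0 i - w' 0 i| <= N^-1) ->
  `|w 0 j - w' 0 j| <= n%:R / (c * N).
Proof.
move=> N0 c0 e e' cj cj' du dw.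
have sq1 (a b s : R) : a ^+ 2 + b = 1 -> 0 <= b -> `|a| <= 1.
  by move=> ab b0; rewrite -(@expr_le1 _ 2)// real_normK ?num_real//; lra.
have u1 : `|u| <= 1 by apply: sq1 e (dot_ge0 _).
have u'1 : `|u'| <= 1 by apply: sq1 e' (dot_ge0 _).
have w1 i : `|w 0 i| <= 1.
  rewrite -(@expr_le1 _ 2)// real_normK ?num_real// (le_trans (coord_le_dot w i))//.
  by have := sqr_ge0 u; lra.
have w'1 i : `|w' 0 i| <= 1.
  rewrite -(@expr_le1 _ 2)// real_normK ?num_real// (le_trans (coord_le_dot w' i))//.
  by have := sqr_ge0 u'; lra.
have step (a b : R) : `|a| <= 1 -> `|b| <= 1 -> `|a - b| <= N^-1 ->
    `|a ^+ 2 - b ^+ 2| <= 2 * N^-1.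
  move=> a1 b1 ab; rewrite subr_sqr normrM mulrC.
  apply: ler_pM => //; apply: (le_trans (ler_normD _ _)); lra.
have E : w 0 j ^+ 2 - w' 0 j ^+ 2 =
    - ((u ^+ 2 - u' ^+ 2) + \sum_(i < n | i != j) (w 0 i ^+ 2 - w' 0 i ^+ 2)).
  move: e e'; rewrite /dot (bigD1 j)//= [X in _ -> _ + X = _ -> _](bigD1 j)//=.
  rewrite sumrB -!expr2.
  under eq_bigr do rewrite -expr2.
  under [X in _ -> _ + (_ + X) = _ -> _]eq_bigr do rewrite -expr2.
  lra.
have up : `|w 0 j ^+ 2 - w' 0 j ^+ 2| <= n%:R * (2 * N^-1).
  rewrite E normrN; apply: (le_trans (ler_normD _ _)).
  rewrite -[n%:R]natr1 addrC mulrDl mul1r lerD//; last exact: step.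
  apply: (le_trans (ler_norm_sum _ _ _)).
  apply: (@le_trans _ _ (\sum_(i < n | i != j) (2 * N^-1))).
    by apply: ler_sum => i ij; apply: step => //; exact: dw.
  rewrite sumr_const -[leLHS]mulr_natl.
  by rewrite (eq_card (B := predC1 j))// cardC1 card_ord.
have low : 2 * c <= `|w 0 j + w' 0 j|.
  have : 2 * c <= (-1) ^+ sg * (w 0 j + w' 0 j) by rewrite mulrDr; lra.
  by move=> /le_trans; apply; rewrite (le_trans (ler_norm _))// normrMsign.
rewrite ler_pdivlMr ?mulr_gt0//.
have Nn : N != 0 by rewrite gt_eqF.
have : `|w 0 j - w' 0 j| * (2 * c) <= n%:R * (2 * N^-1).
  apply: le_trans up; rewrite subr_sqr normrM; exact: ler_wpM2l.
rewrite -(ler_pM2r N0).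
have -> : n%:R * (2 * N^-1) * N = n%:R * 2 by field.
by move: (n%:R : R) => nn; lra.
Qed.

(** Seen from a point of the axis, the slab is a narrow band [|u| <= 1 / k] around the
   equator of the sphere. The band is covered by cells of side [1 / N]: a cell records a
   coordinate [j] of the equatorial part with [|w_j| >= 1 / (2 n)] and the sign of [w_j], and
   confines [u] and the other coordinates to intervals of the grid. The value of [w_j] is
   then confined as well, and [u] meets only [2 N / k + 1] intervals: this is where the
   factor [1 / k] comes from. *)
Lemma sphere_volume_le (p : X) (k : nat) s : is_lift p 0 0 -> (1 < k)%N -> 0 < s ->
  sinh M * cosh s * k%:R <= cosh M * sinh s ->
  (sphere_volume p s <=
   (2 * n%:R * hausdorff_cst n * (9 * n%:R ^+ 2) ^+ n / k%:R * sinh s ^+ n)%:E)%E.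
Proof.
move=> pE k1 s0 thin.
have sh0 : 0 < sinh s by rewrite sinh_gt0.
have shn : sinh s != 0 by rewrite gt_eqF.
have n0 : 0 < n%:R :> R by rewrite ltr0n.
have n1 : 1 <= n%:R :> R by rewrite ler1n.
have k0 : 0 < k%:R :> R by rewrite ltr0n ltnW.
rewrite /sphere_volume (boundary_ball lambda_gt0 pE s0).
apply: hausdorff_measure_le_finite_cover => // delta d0.
(* [N = k m] is large enough for the cells to have diameter at most [delta] *)
pose m := (Num.truncn (3 * n%:R ^+ 2 * sinh s / delta)).+1.
have m0 : 0 < m%:R :> R by rewrite ltr0n.
pose N : R := k%:R * m%:R.
have N0 : 0 < N by rewrite mulr_gt0.
pose r := 3 * n%:R ^+ 2 * sinh s / N.
have c30 : 0 <= 3 * n%:R ^+ 2 * sinh s.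
  exact: mulr_ge0 (mulr_ge0 (ler0n _ 3) (exprn_ge0 2 (ltW n0))) (ltW sh0).
have rd : r <= delta.
  rewrite /r ler_pdivrMr// [leRHS]mulrC -ler_pdivrMr//.
  apply: (@le_trans _ _ m%:R); last first.
    by rewrite /N ler_peMl ?(ltW m0)// ler1n ltnW.
  apply: ltW; rewrite /m; have := @truncn_itv R (3 * n%:R ^+ 2 * sinh s / delta).
  by rewrite divr_ge0 ?(ltW d0)// => /(_ isT)/andP[].
have r0 : 0 <= r.
  by rewrite divr_ge0 ?(ltW N0).
pose J := ('I_n * bool * 'I_(2 * m).+1 * {ffun 'I_n' -> 'I_(2 * (k * m)).+1})%type.
pose U (V : mink R n) := V.1.2 / sinh s.
pose Wv (V : mink R n) : 'rV[R]_n := (sinh s)^-1 *: V.2.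
pose c : R := (2 * n%:R)^-1.
have c0 : 0 < c by rewrite invr_gt0 mulr_gt0.
pose W (t : J) := [set q : X | exists x1 th1, [/\ is_lift q x1 th1,
  `|th1| <= M, - eta (hpt 0 0) (hpt x1 th1) = cosh s &
  let V := hpt x1 th1 in
  [/\ c <= (-1) ^+ t.1.1.2 * Wv V 0 t.1.1.1,
      Num.truncn ((U V + k%:R^-1) * N) = t.1.2 &
      forall i, Num.truncn ((Wv V 0 (lift t.1.1.1 i) + 1) * N) = t.2 i]]].
have time (x1 : 'rV[R]_n) th1 : - eta (hpt 0 0) (hpt x1 th1) = cosh s -> (hpt x1 th1).1.1 = cosh s.
  move=> <-; rewrite /eta {2 3 4}/hpt /= enorm0 cosh0 sinh0 scaler0 dot0l; ring.
have unit x1 th1 : - eta (hpt 0 0) (hpt x1 th1) = cosh s ->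
    U (hpt x1 th1) ^+ 2 + dot (Wv (hpt x1 th1)) (Wv (hpt x1 th1)) = 1.
  move=> h; have := hyperboloid_sqr (hpt_hyperboloid x1 th1).
  rewrite (time _ _ h) cosh2E /U /Wv; move: (hpt x1 th1) => V e; rewrite !dotE.
  transitivity ((V.1.2 ^+ 2 + dot V.2 V.2) / sinh s ^+ 2); first by field.
  have -> : V.1.2 ^+ 2 + dot V.2 V.2 = sinh s ^+ 2 by lra.
  by rewrite divff// expf_neq0.
have chord (V V' : mink R n) : V.1.1 = V'.1.1 -> eta (lincomb 1 V (-1) V') (lincomb 1 V (-1) V') =
    sinh s ^+ 2 * ((U V - U V') ^+ 2 + dot (Wv V - Wv V') (Wv V - Wv V')).
  rewrite /eta /lincomb /U /Wv /= => ->; rewrite !dotE.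
  by move: (dot V.2 V.2) (dot V.2 V'.2) (dot V'.2 V.2) (dot V'.2 V'.2) => t3 t4 t5 t6; field.
have band x1 th1 : `|th1| <= M -> - eta (hpt 0 0) (hpt x1 th1) = cosh s ->
    `|U (hpt x1 th1)| <= k%:R^-1.
  move=> thM h; have := slab_cone x1 thM; rewrite (time _ _ h) => cone.
  rewrite /U normrM normrV ?unitfE// (gtr0_norm sh0) ler_pdivrMr// mulrC ler_pdivlMr//.
  have cM := cosh_gt0 M; rewrite -(ler_pM2l cM) mulrA.
  by apply: le_trans thin; rewrite ler_pM2r.
have Wle1 x1 th1 i : - eta (hpt 0 0) (hpt x1 th1) = cosh s -> `|Wv (hpt x1 th1) 0 i| <= 1.
  move=> h; rewrite -(@expr_le1 _ 2)// real_normK ?num_real//.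
  rewrite (le_trans (coord_le_dot _ i))// -(unit _ _ h) lerDr; exact: sqr_ge0.
exists J, W, r; split; first by rewrite r0 rd.
- move=> [[[j sg] a] b] q q' [x1 [th1 [qE thM e [/= cj ta tb]]]]
    [x2 [th2 [q'E thM' e' [/= cj' ta' tb']]]].
  set V := hpt x1 th1 in e cj ta tb; set V' := hpt x2 th2 in e' cj' ta' tb'.
  have scal (y z t : R) : `|(y + t) * N - (z + t) * N| <= 1 -> `|y - z| <= N^-1.
    have -> : (y + t) * N - (z + t) * N = (y - z) * N by ring.
    by rewrite normrM (gtr0_norm N0) -ler_pdivlMr// div1r.
  have pos (y t : R) : `|y| <= t -> 0 <= (y + t) * N.
    by rewrite ler_norml => /andP[h _]; rewrite mulr_ge0 ?(ltW N0)//; lra.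
  have dU : `|U V - U V'| <= N^-1.
    apply: (scal _ _ k%:R^-1); apply: truncn_dist; last by rewrite ta ta'.
      by apply: pos; exact: band.
    by apply: pos; exact: band.
  have dW i : i != j -> `|Wv V 0 i - Wv V' 0 i| <= N^-1.
    rewrite eq_sym => /unlift_some[i' -> _].
    apply: (scal _ _ 1); apply: truncn_dist; last by rewrite tb tb'.
      by apply: pos; exact: Wle1.
    by apply: pos; exact: Wle1.
  have dj := graph_bound N0 c0 (unit _ _ e) (unit _ _ e') cj cj' dU dW.
  have hV := hpt_hyperboloid x1 th1; have hV' := hpt_hyperboloid x2 th2.
  have [d dp dE] := exists_acosh (eta_hpt_ge1 x1 th1 x2 th2).
  apply: (@le_trans _ _ d).
    by apply: (riem_dist_le_lift lambda_gt0 qE q'E dp); rewrite dE.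
  rewrite -(@ler_pXn2r _ 2)// ?nnegrE//.
  apply: (le_trans (coshB1_ge d)); rewrite dE -(eta_sub hV hV').
  have -> : eta (lincomb 1 (hpt x1 th1) (-1) (hpt x2 th2)) (lincomb 1 (hpt x1 th1) (-1) (hpt x2 th2)) =
      sinh s ^+ 2 * ((U V - U V') ^+ 2 + dot (Wv V - Wv V') (Wv V - Wv V')).
    by apply: chord; rewrite (time _ _ e) (time _ _ e').
  have sqb (t y : R) : `|t| <= y -> t ^+ 2 <= y ^+ 2.
    move=> ty; rewrite -[t ^+ 2]real_normK ?num_real// ler_pXn2r// nnegrE.
    exact: le_trans (normr_ge0 _) ty.
  have b1 := sqb _ _ dU.
  have b2 : dot (Wv V - Wv V') (Wv V - Wv V') <= (n%:R / (c * N)) ^+ 2 + n'%:R * N^-1 ^+ 2.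
    rewrite /dot (bigD1 j)//= lerD//.
      by rewrite -expr2; apply: sqb; rewrite mxE [X in _ + X]mxE.
    apply: (@le_trans _ _ (\sum_(i < n | i != j) N^-1 ^+ 2)).
      by apply: ler_sum => i ij; rewrite -expr2; apply: sqb; rewrite mxE [X in _ + X]mxE; exact: dW.
    rewrite sumr_const -[leLHS]mulr_natl.
    by rewrite (eq_card (B := predC1 j))// cardC1 card_ord.
  have cN : n%:R / (c * N) = 2 * n%:R ^+ 2 * N^-1.
    by rewrite /c; field; rewrite !gt_eqF.
  rewrite /r.
  have -> : (3 * n%:R ^+ 2 * sinh s / N) ^+ 2 = sinh s ^+ 2 * (9 * n%:R ^+ 4 * N^-1 ^+ 2).
    by field; rewrite gt_eqF.
  rewrite ler_pM2l ?exprn_gt0//.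
  rewrite cN in b2.
  apply: (@le_trans _ _ (N^-1 ^+ 2 + ((2 * n%:R ^+ 2 * N^-1) ^+ 2 + n'%:R * N^-1 ^+ 2))).
    exact: lerD.
  have nn : n%:R = n'%:R + 1 :> R by rewrite natr1.
  have -> : N^-1 ^+ 2 + ((2 * n%:R ^+ 2 * N^-1) ^+ 2 + n'%:R * N^-1 ^+ 2) =
      (n%:R + 4 * n%:R ^+ 4) * N^-1 ^+ 2 by rewrite nn; ring.
  rewrite ler_wpM2r ?exprn_ge0 ?invr_ge0 ?(ltW N0)//.
  have : (n%:R : R) <= n%:R ^+ 4 by rewrite ler_eXnr.
  by move: (n%:R : R) n0 => y y0; have := exprn_ge0 4 (ltW y0); lra.
- move=> q [x1 [th1 [qE thM e]]].
  set V := hpt x1 th1 in e.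
  have kN2 : k%:R^-1 <= 2^-1 :> R by rewrite lef_pV2 ?posrE// ler_nat.
  have [j [sg cj]] : exists j sg, c <= (-1) ^+ (sg : bool) * Wv V 0 j.
    have [j jmax] : exists j, c <= `|Wv V 0 j|.
      apply: contrapT => none.
      have lt j : `|Wv V 0 j| < c by rewrite ltNge; apply/negP => h; apply: none; exists j.
      have b := band _ _ thM e; rewrite -/V in b.
      have u2 : U V ^+ 2 <= 2^-1 ^+ 2.
        rewrite -[leLHS]real_normK ?num_real// ler_pXn2r// ?nnegrE//.
        exact: le_trans b kN2.
      have d2 : dot (Wv V) (Wv V) <= \sum_(i < n) c ^+ 2.
        apply: ler_sum => i _; rewrite -expr2 -[leLHS]real_normK ?num_real//.
        by rewrite ler_pXn2r ?nnegrE ?(ltW c0)// ltW.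
      rewrite sumr_const card_ord -[leRHS]mulr_natl in d2.
      have := unit _ _ e; rewrite -/V.
      have nc : n%:R * c = 2^-1 by rewrite /c; field; rewrite gt_eqF.
      have c1 : c <= 2^-1 by rewrite -nc ler_peMl ?(ltW c0).
      have : n%:R * c ^+ 2 <= 2^-1 * 2^-1.
        by rewrite expr2 mulrA nc ler_pM2l.
      lra.
    exists j, (Wv V 0 j < 0); apply: le_trans jmax _.
    case: ltP => h; first by rewrite expr1 mulN1r ltr0_norm.
    by rewrite expr0 mul1r ger0_norm.
  have bnd (y t : R) (l : nat) : `|y| <= t -> t * N = l%:R -> (Num.truncn ((y + t) * N) < (2 * l).+1)%N.
    rewrite ler_norml => /andP[h1 h2] tN.
    have y0 : 0 <= (y + t) * N by rewrite mulr_ge0 ?(ltW N0)//; lra.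
    have /andP[t1 _] := truncn_itv y0.
    rewrite ltnS -(@ler_nat R) (le_trans t1)// natrM -tN [leRHS]mulrA ler_pM2r//; lra.
  have aP : (Num.truncn ((U V + k%:R^-1) * N) < (2 * m).+1)%N.
    apply: bnd; first exact: band.
    by rewrite /N mulKf// gt_eqF.
  have bP (i : 'I_n') : (Num.truncn ((Wv V 0 (lift j i) + 1) * N)%R < (2 * (k * m)).+1)%N.
    by apply: bnd; [exact: Wle1|rewrite mul1r natrM].
  exists (j, sg, Ordinal aP, [ffun i => Ordinal (bP i)]) => //.
  exists x1, th1; split => //=; split => // i.
  by rewrite ffunE.
- rewrite /J !card_prod card_ffun !card_ord card_bool.
  have cst0 := hausdorff_cst_gt0 (R := R) n.
  rewrite /r; have -> : 2 * n%:R * hausdorff_cst n * (9 * n%:R ^+ 2) ^+ n / k%:R * sinh s ^+ n =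
      hausdorff_cst n * (2 * n%:R * (9 * n%:R ^+ 2) ^+ n / k%:R * sinh s ^+ n).
    by move: (hausdorff_cst n) ((9 * _) ^+ n) (sinh s ^+ n) => h a b; ring.
  rewrite ler_pM2l//.
  have -> : 3 * n%:R ^+ 2 * sinh s / N = (3 * N)^-1 * (9 * n%:R ^+ 2 * sinh s).
    by field; rewrite gt_eqF.
  have N30 : 0 < (3 * N) ^+ n by rewrite exprn_gt0// mulr_gt0.
  have gen (C A B E t : R) l : 0 < A ^+ l -> 0 <= B -> 0 <= E -> C <= t * A ^+ l ->
      C * (A^-1 * (B * E)) ^+ l <= t * B ^+ l * E ^+ l.
    move=> A0 B0 E0 CA; rewrite !exprMn exprVn -!mulrA (mulrA C).
    by rewrite ler_wpM2r ?mulr_ge0 ?exprn_ge0// ler_pdivrMr.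
  have -> : 2 * n%:R * (9 * n%:R ^+ 2) ^+ n / k%:R = (2 * n%:R / k%:R) * (9 * n%:R ^+ 2) ^+ n :> R.
    by move: ((9 * _) ^+ n) => h; ring.
  apply: gen; [exact: N30|by rewrite mulr_ge0|exact: ltW sh0|].
  rewrite !natrM natrX.
  have m1 : 1 <= m%:R :> R by rewrite ler1n.
  have k1' : 1 <= k%:R :> R by rewrite ler1n ltnW.
  have h1 : ((2 * m).+1)%:R <= 3 * m%:R :> R by rewrite -natr1 natrM; lra.
  have h2 : ((2 * (k * m)).+1)%:R <= 3 * N :> R.
    rewrite -natr1 !natrM -/N; have : 1 * 1 <= N by apply: ler_pM.
    lra.
  have h3 : ((2 * (k * m)).+1)%:R ^+ n' <= (3 * N) ^+ n' :> R.
    by rewrite lerXn2r// nnegrE// mulr_ge0// ltW.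
  have h4 : ((2 * m).+1)%:R * ((2 * (k * m)).+1)%:R ^+ n' <= (3 * m%:R) * (3 * N) ^+ n' :> R.
    by apply: ler_pM => //; exact: exprn_ge0.
  have -> : 2 * n%:R / k%:R * (3 * N) ^+ n = n%:R * 2 * ((3 * m%:R) * (3 * N) ^+ n').
    rewrite exprS; move: ((3 * N) ^+ n') => h; rewrite /N; field; rewrite gt_eqF//.
  by rewrite -mulrA ler_pM2l// mulr_gt0.
Qed.

End UpperVolume.

(** * Limits of the normalized volumes *)

Section Asymptotics.
Context {R : realType}.
Variables (n : nat) (lambda : R).
Hypothesis lambda_gt0 : 0 < lambda.
Implicit Types p : X n lambda.

Lemma cvg_expRN_sinh : expR (- s) * sinh s @[s --> +oo] --> (2^-1 : R).
Proof.
have -> : (fun s : R => expR (- s) * sinh s) = fun s => 2^-1 - expR (- s) * expR (- s) * 2^-1.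
  apply/funext => s; rewrite /sinh; have := expRMN s; set a := expR s; set b := expR (- s) => h.
  by transitivity ((a * b - b * b) / 2); [ring|rewrite h; field].
rewrite -[X in _ --> X]subr0; apply: cvgB; first exact: cvg_cst.
rewrite -[X in _ --> X](mul0r 2^-1); apply: cvgM; last exact: cvg_cst.
by rewrite -[X in _ --> X](mul0r 0); apply: cvgM; exact: cvgr_expR.
Qed.

Lemma cvg_expRN_sinh_exp :
  (expR (- (n%:R * s)) * sinh s ^+ n)%:E @[s --> +oo] --> ((2^-1) ^+ n : R)%:E.
Proof.
apply: cvg_EFin; first by near=> s.
have -> : fine \o (fun s : R => (expR (- (n%:R * s)) * sinh s ^+ n)%:E) =
    fun s => (expR (- s) * sinh s) ^+ n.
  by apply/funext => s /=; rewrite (exprMn n (expR (- s)) (sinh s)) -expRM_natl mulrN.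
apply: (@continuous_cvg _ _ _ _ _ (fun s : R => expR (- s) * sinh s) (fun x => x ^+ n)).
  exact: exprn_continuous.
exact: cvg_expRN_sinh.
Unshelve. all: by end_near. Qed.

(** By monotonicity of [sphere_volume p s / sinh s ^+ n] the limit defining the relative
   volume exists. *)
Lemma sphere_volume_cvg p x0 : is_lift p x0 0 ->
  exists l : \bar R, ((expR (- (n%:R * s)))%:E * sphere_volume p s)%E @[s --> +oo%R] --> l.
Proof.
move=> pE.
pose F (s : R) : \bar R := if 0 < s then ((sinh s ^- n)%:E * sphere_volume p s)%E else +oo%E.
have shn (s : R) : 0 < s -> 0 < sinh s ^+ n by move=> s0; rewrite exprn_gt0// sinh_gt0.
have Fni : nonincreasing_fun F.
  move=> s1 s2; rewrite le_eqVlt => /predU1P[->//|s12].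
  rewrite /F; case: (ltrP 0 s1) => s10; last by rewrite leey.
  have s20 : 0 < s2 by exact: lt_trans s12.
  rewrite s20 lee_pdivrMl ?shn//.
  apply: (le_trans (sphere_volume_mono lambda_gt0 pE s10 s12)).
  by rewrite expr_div_n EFinM -muleA.
have Fc := nonincreasing_cvge Fni.
have dfd : ((2^-1 ^+ n)%:E *? ereal_inf (range F))%E.
  by rewrite /mule_def; case: (ereal_inf _) => //; rewrite gt_eqF// exprn_gt0// invr_gt0.
exists ((2^-1 ^+ n)%:E * ereal_inf (range F))%E.
apply: cvg_trans (cvgeM dfd cvg_expRN_sinh_exp Fc).
apply: near_eq_cvg; near=> s.
have s0 : 0 < s by near: s; exact: nbhs_pinfty_gt.
rewrite /F s0 muleA -EFinM -mulrA divff ?mulr1//.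
by rewrite gt_eqF// shn.
Unshelve. all: by end_near. Qed.

Lemma cvg_expRN_sinh_expZ (b : R) :
  ((expR (- (n%:R * s)))%:E * (b * sinh s ^+ n)%:E)%E @[s --> +oo%R] --> (2^-1 ^+ n * b)%:E.
Proof.
have -> : (fun s : R => (expR (- (n%:R * s)))%:E * (b * sinh s ^+ n)%:E)%E =
    fun s => ((expR (- (n%:R * s)) * sinh s ^+ n)%:E * b%:E)%E.
  by apply/funext => s; rewrite -!EFinM; congr EFin; rewrite -mulrA (mulrC b).
by rewrite EFinM; apply: cvgeZr => //; exact: cvg_expRN_sinh_exp.
Qed.

Lemma volume_limit_ge p x0 (b : R) : is_lift p x0 0 ->
  (forall s, 1 <= s -> ((b * sinh s ^+ n)%:E <= sphere_volume p s)%E) ->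
  ((2^-1 ^+ n * b)%:E <=
   lim ((expR (- (n%:R * s)))%:E * sphere_volume p s @[s --> +oo%R]))%E.
Proof.
move=> pE bV; have [l Gl] := sphere_volume_cvg pE.
have Hb := @cvg_expRN_sinh_expZ b.
rewrite -(cvg_lim _ Hb)//; apply: lee_lim.
- by apply/cvg_ex; exists (2^-1 ^+ n * b)%:E.
- by apply/cvg_ex; exists l.
near=> s; rewrite lee_wpmul2l ?lee_fin ?expR_ge0//.
by apply: bV; near: s; exact: nbhs_pinfty_ge.
Unshelve. all: by end_near. Qed.

Lemma volume_limit_le p x0 (b : R) : is_lift p x0 0 ->
  (forall s, 1 <= s -> (sphere_volume p s <= (b * sinh s ^+ n)%:E)%E) ->
  (lim ((expR (- (n%:R * s)))%:E * sphere_volume p s @[s --> +oo%R]) <=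
   (2^-1 ^+ n * b)%:E)%E.
Proof.
move=> pE bV; have [l Gl] := sphere_volume_cvg pE.
have Hb := @cvg_expRN_sinh_expZ b.
rewrite -(cvg_lim _ Hb)//; apply: lee_lim.
- by apply/cvg_ex; exists l.
- by apply/cvg_ex; exists (2^-1 ^+ n * b)%:E.
near=> s; rewrite lee_wpmul2l ?lee_fin ?expR_ge0//.
by apply: bV; near: s; exact: nbhs_pinfty_ge.
Unshelve. all: by end_near. Qed.

End Asymptotics.

Theorem lemma4p4 (R : realType) (n : nat) (hn : (2 <= n)%N) :
  exists2 lambda0 : R, 0 < lambda0 &
    forall lambda : R, 0 < lambda -> lambda < lambda0 ->
      ~ (exists c : \bar R, forall p : X n lambda, relative_volume p = c).
Proof.
case: n hn => // n' hn; set n := n'.+1.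
have c0 : 0 < hausdorff_cst n :> R := hausdorff_cst_gt0 n.
have n0 : 0 < n%:R :> R by rewrite ltr0n.
pose lo : R := hausdorff_cst n / (4 * n%:R) ^+ n.
have lo0 : 0 < lo by rewrite divr_gt0// exprn_gt0// mulr_gt0.
pose up : R := 2 * n%:R * hausdorff_cst n * (9 * n%:R ^+ 2) ^+ n.
have up0 : 0 < up.
  have h9 : 0 < (9 * n%:R ^+ 2) ^+ n :> R by rewrite exprn_gt0// mulr_gt0// exprn_gt0.
  by apply: mulr_gt0 h9; apply: mulr_gt0 c0; apply: mulr_gt0.
(* with this [k] the upper bound [up / k] on the axis is below [lo] *)
pose k := (Num.truncn (up / lo)).+2.
have kbig : up / k%:R < lo.
  rewrite ltr_pdivrMr ?ltr0n// mulrC -ltr_pdivrMr//.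
  have := @truncn_itv R (up / lo); rewrite divr_ge0 ?(ltW lo0) ?(ltW up0)// => /(_ isT)/andP[_].
  by move=> /lt_le_trans; apply; rewrite ler_nat.
have k0 : 0 < k%:R :> R by rewrite ltr0n.
have k2 : 2 <= k%:R :> R by rewrite ler_nat.
have pi0 : 0 < pi :> R by exact: pi_gt0.
(* the thinness of the band follows from [4 * M * k <= 1], by [sinh M <= 2 * M] and
   [cosh s <= 2 * sinh s] *)
exists (4 * k%:R * pi)^-1; first by rewrite invr_gt0 !mulr_gt0.
move=> lambda l0 ll0 [c Hc].
pose M := pi * lambda.
have M0 : 0 < M by rewrite mulr_gt0.
have Mk : 4 * M * k%:R <= 1.
  have : lambda * (4 * k%:R * pi) < 1 by rewrite -ltr_pdivlMr ?div1r// !mulr_gt0.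
  by rewrite /M; lra.
have M8 : M <= 8^-1 by nra.
have shM : sinh M <= 2 * M.
  have := @sinh_le_quadratic R M (ltW M0); nra.
have thin s : 1 <= s -> sinh M * cosh s * k%:R <= cosh M * sinh s.
  move=> s1; have cM := cosh_ge1 M.
  have sh0 : 0 < sinh s by rewrite sinh_gt0; lra.
  have cs : cosh s <= 2 * sinh s.
    have e1 := expR_ge1Dx s; have := expRMN s; have := expR_gt0 (- s).
    by rewrite /cosh /sinh; move: (expR s) (expR (- s)) e1 => a b; nra.
  have c1 := cosh_gt0 s.
  apply: (@le_trans _ _ (2 * M * (2 * sinh s) * k%:R)).
    rewrite ler_pM2r//; apply: ler_pM => //; first by rewrite sinh_ge0 ltW.
    exact: ltW.
  have -> : 2 * M * (2 * sinh s) * k%:R = 4 * M * k%:R * sinh s by ring.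
  by rewrite ler_pM2r// (le_trans Mk).
have upper : (lim ((expR (- (n%:R * s)))%:E *
    sphere_volume (pt l0 (0 : 'rV[R]_n) 0) s @[s --> +oo%R]) <=
    (2^-1 ^+ n * (up / k%:R))%:E)%E.
  apply: (volume_limit_le l0 (pt_lift l0 _ _)) => s s1.
  by apply: (sphere_volume_le l0 (pt_lift l0 _ _)) => //; [lra|exact: thin].
have sM0 : 0 < sinh M by rewrite sinh_gt0.
have [t0 t00 t0E] : exists2 t0 : R, 0 <= t0 & cosh t0 = 2 * cosh M / sinh M.
  apply: exists_acosh; rewrite ler_pdivlMr// mul1r.
  by have := coshBsinh_gt0 M; have := cosh_gt0 M; lra.
have lower : ((2^-1 ^+ n * lo)%:E <= lim ((expR (- (n%:R * s)))%:E *
    sphere_volume (pt l0 (t0 *: e0 n') 0) s @[s --> +oo%R]))%E.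
  apply: (volume_limit_ge l0 (pt_lift l0 _ _)) => s s1.
  apply: (sphere_volume_ge l0 (pt_lift l0 _ _)) => //; first by lra.
  by rewrite t0E [leRHS]mulrC divfK// gt_eqF.
have := Hc (pt l0 (0 : 'rV[R]_n) 0); rewrite -(Hc (pt l0 (t0 *: e0 n') 0)).
rewrite /relative_volume => E.
have h2 : 0 < 2 ^+ n :> R by rewrite exprn_gt0.
have : ((2 ^+ n)%:E * (2^-1 ^+ n * lo)%:E <= (2 ^+ n)%:E * (2^-1 ^+ n * (up / k%:R))%:E :> \bar R)%E.
  apply: (@le_trans _ _ ((2 ^+ n)%:E * lim ((expR (- (n%:R * s)))%:E *
    sphere_volume (pt l0 (t0 *: e0 n') 0) s @[s --> +oo%R]))%E).
    by rewrite lee_wpmul2l// lee_fin ltW.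
  by rewrite -E lee_wpmul2l// lee_fin ltW.
rewrite -!EFinM lee_fin ler_pM2l// ler_pM2l ?exprn_gt0 ?invr_gt0//.
by rewrite leNgt kbig.
Qed.
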